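(* Let $\mathbb G$ be a Carnot group, $j\in\{1,\dots,n_1\}$, and $f\in L_1(\mathbb G)$. Then (1) for $\mathcal H^{\nu-1}$-a.e. $p\in\Pi_j$ the function $t\mapsto f(p\exp(tX_j))$ is integrable on $\mathbb R$; (2) for a.e. $t\in\mathbb R$ the function $p\mapsto f(p\exp(tX_j))$ is $\mathcal H^{\nu-1}$-integrable on $\Pi_j$; (3) \[ \int_{\Pi_j}d\mathcal H^{\nu-1}(p)\int_{\mathbb R}f(p\exp(tX_j))\,dt=\int_{\mathbb R}dt\int_{\Pi_j}f(p\exp(tX_j))\,d\mathcal H^{\nu-1}(p)=\frac{\Theta_{\Pi_j}}{\Theta_{\mathbb G}}\int_{\mathbb G}f(x)\,d\mathcal H^\nu(x). \]
   Context: $\mathbb{G}$ is a Carnot group: a connected simply connected nilpotent Lie group whose Lie algebra $\mathfrak{g}$ of left-invariant vector fields splits as $\mathfrak{g}=V_1\oplus\dots\oplus V_m$ with $[V_1,V_k]=V_{k+1}$ ($V_{m+1}=\{0\}$); $n_k=\dim V_k$, $N=\dim\mathfrak g$. Fix a basis $X_1,\dots,X_N$ ordered by degree with each $V_k$ spanned by a subcollection, $\sigma_i=k$ if $X_i\in V_k$. Points are identified with canonical coordinates $(x_1,\dots,x_N)=\exp(\sum x_iX_i)(e)$; $\nu=\sum_i\sigma_i$. $\rho$ is the Carnot--Carath\'eodory distance determined by a scalar product on $V_1$; $\mathcal H^s$ denotes the spherical Hausdorff measure w.r.t. $\rho$ ($\mathcal H^s=\sup_\varepsilon\beta_s\inf\{\sum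 r_k^s: \text{covers by balls of radius } r_k\le\varepsilon\}$, normalizing constants $\beta_s>0$). $\mathcal H^\nu=\Theta_{\mathbb G}\mathcal L^N$ with $\mathcal L^N$ Lebesgue measure in coordinates, and $L_1(\mathbb G)$ refers to this measure. $\Pi_j=\{x: x_j=0\}$ for $j\le n_1$, and $\mathcal H^{\nu-1}=\Theta_{\Pi_j}\mathcal L^{N-1}$ on $\Pi_j$, with $\mathcal L^{N-1}$ Lebesgue measure on $\Pi_j$ in coordinates and $\Theta_{\Pi_j}>0$ a constant. *)

(* Defs.v *)
From HB Require Import structures.
From mathcomp Require Import all_boot all_order all_algebra.
From mathcomp Require Import all_classical all_reals all_analysis.
Set Implicit Arguments. Unset Strict Implicit. Unset Printing Implicit Defensive.
Import Order.TTheory GRing.Theory Num.Theory.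
Import numFieldNormedType.Exports.
Local Open Scope classical_set_scope.
Local Open Scope ring_scope.

(* Lie algebra structure on R^N ('rV[R]_N) given by structure constants:  *)
(*   [e_a, e_b] = \sum_k c a b k e_k,  e_i the canonical basis vectors     *)
(* (e_i corresponds to the left-invariant field X_i).                     *)
Section Carnot.
Variables (R : realType) (N : nat).
Implicit Types (c : 'I_N -> 'I_N -> 'I_N -> R) (x y z : 'rV[R]_N).

Definition ebasis (i : 'I_N) : 'rV[R]_N := \row_k (if k == i then 1 else 0).

Definition lie_br c x y : 'rV[R]_N :=
  \row_k \sum_(a < N) \sum_(b < N) x ord0 a * y ord0 b * c a b k.

(* Carnot (stratified) Lie algebra with graded basis: sigma i = degree of
   e_i, i.e. e_i \in V_(sigma i); the basis is ordered by degree;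
   V_k = span {e_i | sigma i = k}; [V_1, V_k] = V_(k+1) for every k >= 1
   (with V_(m+1) = 0 for m the top degree). *)
Definition carnot_algebra c (sigma : 'I_N -> nat) : Prop :=
  [/\ (forall a b k, c a b k = - c b a k),
      (forall x y z, lie_br c x (lie_br c y z) + lie_br c y (lie_br c z x)
                     + lie_br c z (lie_br c x y) = 0),
      (forall i, (0 < sigma i)%N) /\
      (forall i i' : 'I_N, (i <= i')%N -> (sigma i <= sigma i')%N),
      (* [V_1, V_k] is contained in V_(k+1) *)
      (forall a b k, sigma a = 1%N -> c a b k != 0 -> sigma k = (sigma b).+1)
    & (* V_(k+1) is contained in [V_1, V_k] *)
      (forall k, (1 < sigma k)%N ->
         exists lam : 'I_N -> 'I_N -> R,
           ebasis k = \sum_(a < N | sigma a == 1%N)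
                      \sum_(b < N | (sigma b).+1 == sigma k)
                        lam a b *: lie_br c (ebasis a) (ebasis b))].

Fixpoint nest_br c (w : seq 'rV[R]_N) : 'rV[R]_N :=
  match w with
  | [::] => 0
  | [:: v] => v
  | v :: w' => lie_br c v (nest_br c w')
  end.

(* Dynkin's form of the Baker-Campbell-Hausdorff series
     log(exp x exp y) = \sum_(n>=1) (-1)^(n-1)/n
        \sum_(r_i + s_i > 0) [x^r1 y^s1 ... x^rn y^sn]
                             / ((\sum_i (r_i+s_i)) * \prod_i r_i! s_i!)
   truncated to n <= N and r_i, s_i <= N; since a Carnot algebra of
   dimension N is nilpotent of step <= N, all omitted terms vanish, so
   this is the full BCH series. *)
Definition bch c (x y : 'rV[R]_N) : 'rV[R]_N :=
  \sum_(n < N)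
   \sum_(r : {ffun 'I_n.+1 -> 'I_N.+1})
    \sum_(s : {ffun 'I_n.+1 -> 'I_N.+1} | [forall i, (0 < r i + s i)%N])
      let w := flatten [seq nseq (r i) x ++ nseq (s i) y | i <- enum 'I_n.+1] in
      ((-1) ^+ n / n.+1%:R
        / ((size w)%:R * \prod_(i < n.+1) ((r i)`! * (s i)`!)%:R))
        *: nest_br c w.

(* Group law of the Carnot group in canonical (exponential) coordinates:
   the point x = exp(\sum_i x_i X_i)(e); p * q = exp(bch(log p, log q)). *)
Definition cmul c (p q : 'rV[R]_N) : 'rV[R]_N := bch c p q.

Definition expX (j : 'I_N) (t : R) : 'rV[R]_N := t *: ebasis j.

(* Lebesgue measure in coordinates, on the coordinate subspace            *)
(*   plane S = {x | x_i = 0 for i \notin S},                               *)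
(* defined as the Lebesgue outer measure (covers by countably many closed  *)
(* coordinate boxes; a cover element may be empty = None).               *)
(* S = predT gives L^N on R^N; S = [pred i | i != j] gives L^(N-1) on Pi_j *)
Definition coord_plane (S : pred 'I_N) : set 'rV[R]_N :=
  [set x | forall i, ~~ S i -> x ord0 i = 0].

Definition coord_box (S : pred 'I_N) (ab : 'rV[R]_N * 'rV[R]_N) : set 'rV[R]_N :=
  [set x | forall i, S i -> ab.1 ord0 i <= x ord0 i <= ab.2 ord0 i].

Definition box_vol (S : pred 'I_N) (o : option ('rV[R]_N * 'rV[R]_N)) : R :=
  if o is Some ab then \prod_(i < N | S i) (ab.2 ord0 i - ab.1 ord0 i) else 0.

Definition box_set (S : pred 'I_N) (o : option ('rV[R]_N * 'rV[R]_N))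
  : set 'rV[R]_N := if o is Some ab then coord_box S ab else set0.

Definition leb_outer (S : pred 'I_N) (A : set 'rV[R]_N) : \bar R :=
  ereal_inf [set (\sum_(0 <= k <oo) (box_vol S (F k))%:E)%E
            | F in [set F : nat -> option ('rV[R]_N * 'rV[R]_N) |
                (forall k ab, F k = Some ab -> forall i, ab.1 ord0 i <= ab.2 ord0 i)
                /\ A `&` coord_plane S `<=` \bigcup_k box_set S (F k)]].

(* Lebesgue sigma-algebra: generated by the (Borel) closed boxes of R^N and
   the null sets of leb_outer S (i.e. the completion). *)
Definition leb_gen (S : pred 'I_N) : set (set 'rV[R]_N) :=
  [set A | (exists ab, A = coord_box predT ab) \/ leb_outer S A = 0%E].

Definition lebType (S : pred 'I_N) := g_sigma_algebraType (leb_gen S).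

Definition Pi (j : 'I_N) : set 'rV[R]_N := [set x | x ord0 j = 0].

End Carnot.

(* Main.v *)
(** Slicing [R^N] along the [j]-th coordinate, Tonelli's theorem gives
    [L^N = L^(N-1) x L^1]. In canonical coordinates the bracket is graded, so
    the Baker-Campbell-Hausdorff formula shows that the map sending [p + t e_j]
    to [p exp(t X_j)], for [p] in [Pi_j], adds to every coordinate a polynomial
    in the previous ones. Such a triangular map is a composition of shears, each
    of which preserves [L^N] by translation invariance on its slices. The theorem
    is then Fubini's theorem for a Borel representative of [f]; the exceptional
    null set has null sections almost everywhere. *)

Require Import Defs.
From HB Require Import structures.
From mathcomp Require Import all_boot all_order all_algebra.
From mathcomp Require Import all_classical all_reals all_analysis.
From mathcomp Require Import measurable_realfun.
Set Implicit Arguments. Unset Strict Implicit. Unset Printing Implicit Defensive.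
Import Order.TTheory GRing.Theory Num.Theory.
Import numFieldNormedType.Exports.
Local Open Scope classical_set_scope.
Local Open Scope ring_scope.

(** Two mismatches shape the proof. The measures are outer measures of box covers on a sigma-algebra
    enlarged by null sets, whereas products, sections and preimages are under control only for Borel
    sets: the preimage of a null set need not be measurable in a product. The geometry is therefore
    done on [borelType], and the completions enter only through comparison lemmas, at the price of
    Borel null sets. Moreover Pi_j gets no type of its own: [leb_outer S] lives on all of R^N and is
    concentrated on [coord_plane S], so a point of the factor Pi_j is a full vector whose j-th
    coordinate gets overwritten. Triangularity comes from indices rather than degrees: a nonzero
    structure constant [c a b k] forces k above both a and b. A BCH word with at least two letters
    thus reaches coordinate i only through earlier coordinates, and the words with one letter sum to
    x + y. *)

Section coordinates.
Variables (R : realType) (N : nat).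
Implicit Types (x : 'rV[R]_N) (i k : 'I_N) (t : R).

Definition set_coord i x t : 'rV[R]_N :=
  \row_k (if k == i then t else x ord0 k).

Lemma set_coordE i x t k :
  set_coord i x t ord0 k = if k == i then t else x ord0 k.
Proof. by rewrite mxE. Qed.

(** One integer bounding all coordinates at once, used to exhaust R^N by integer cubes. *)
Definition coord_bound x : nat := (Num.truncn (\sum_(k < N) `|x ord0 k|)).+1.

Lemma norm_coord_le x k : `|x ord0 k| <= (coord_bound x)%:R.
Proof.
apply: le_trans (ltW (truncnS_gt _)).
by rewrite (bigD1 k)//= lerDl sumr_ge0.
Qed.

End coordinates.

(** * The Lebesgue outer measure of a coordinate plane *)

Section leb_outer.
Variables (R : realType) (N : nat) (S : pred 'I_N).
Local Notation rV := 'rV[R]_N.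
Implicit Types (A B X : set rV) (o : option (rV * rV)).

(** Ordered endpoints keep the product of side lengths nonnegative. *)
Definition valid_box o : Prop :=
  forall ab, o = Some ab -> forall i, ab.1 ord0 i <= ab.2 ord0 i.

Definition box_cover A : set (nat -> option (rV * rV)) :=
  [set F | (forall k, valid_box (F k)) /\
           A `&` coord_plane S `<=` \bigcup_k box_set S (F k)].

Local Open Scope ereal_scope.

Lemma leb_outerE A : leb_outer S A =
  ereal_inf [set \sum_(0 <= k <oo) (box_vol S (F k))%:E | F in box_cover A].
Proof. by []. Qed.

Lemma box_vol_ge0 o : valid_box o -> (0 <= box_vol S o)%R.
Proof.
case: o => [ab|//] /(_ _ erefl) h /=.
by apply: prodr_ge0 => i _; rewrite subr_ge0.
Qed.

Lemma leb_outer_ge0 A : 0 <= leb_outer S A.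
Proof.
rewrite leb_outerE; apply: le_ereal_inf_tmp => x [F [vF _] <-{x}].
by apply: nneseries_ge0 => k _ _; rewrite lee_fin box_vol_ge0.
Qed.

Lemma le_leb_outer_plane A B : A `&` coord_plane S `<=` B ->
  leb_outer S A <= leb_outer S B.
Proof.
move=> AB; rewrite !leb_outerE; apply/ereal_inf_le_tmp => x [F [vF BF] <-{x}].
exists F => //; split => // z [Az Pz]; apply: BF; split => //.
by apply: AB; split.
Qed.

Lemma le_leb_outer : {homo @leb_outer R N S : A B / A `<=` B >-> A <= B}.
Proof. by move=> A B AB; apply: le_leb_outer_plane => x [/AB]. Qed.

Lemma leb_outer_box (ab : rV * rV) : (forall i, ab.1 ord0 i <= ab.2 ord0 i)%R ->
  leb_outer S (coord_box S ab) <= (box_vol S (Some ab))%:E.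
Proof.
move=> h; rewrite leb_outerE; apply: ereal_inf_lbound.
pose F k := if k == 0%N then Some ab else None.
have vF k : valid_box (F k) by rewrite /F; case: eqP => // _ ab' [<-].
exists F; first by split => // x [Ax _]; exists 0%N.
rewrite (@nneseries_split _ _ 0 1)//; last first.
  by move=> k _; rewrite lee_fin box_vol_ge0.
rewrite big_nat1 eseries0 ?adde0// => k k0 _.
by rewrite /F gtn_eqF.
Qed.

Lemma leb_outer0 : leb_outer S (set0 : set rV) = 0.
Proof.
apply/eqP; rewrite eq_le leb_outer_ge0 andbT leb_outerE.
apply: ereal_inf_lbound; exists (fun=> None); first by split => // x [].
by rewrite eseries0.
Qed.

(** Each [A n] gets a cover within e / 2^(n+1) of its outer measure. A bijection between nat and nat
    * nat merges these covers into one sequence, and its total volume is regrouped as a double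
    series. *)
Lemma leb_outer_sigma_subadditive : sigma_subadditive (@leb_outer R N S).
Proof.
move=> A; have [[i ioo]|] := pselect (exists i, leb_outer S (A i) = +oo).
  rewrite (eseries_pinfty _ _ ioo) ?leey// => n _.
  by rewrite -ltNye (lt_le_trans _ (leb_outer_ge0 _)).
rewrite -forallNE => Aoo.
apply/lee_addgt0Pr => e e0.
rewrite (le_trans _ (epsilon_trick _ _ (ltW e0)))//; last first.
  by move=> n; exact: leb_outer_ge0.
pose P n F := box_cover (A n) F /\
  \sum_(0 <= k <oo) (box_vol S (F k))%:E <=
  leb_outer S (A n) + (e / (2 ^ n.+1)%:R)%:E.
have [G PG] : {G & forall n, P n (G n)}.
  apply: (@choice _ _ P) => n; rewrite /P.
  have en1 : (0 < e / (2 ^ n.+1)%:R)%R by rewrite divr_gt0// ltr0n expn_gt0.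
  have /(lb_ereal_inf_adherent en1)[x [F cF <-] xS] :
      leb_outer S (A n) \is a fin_num.
    by rewrite ge0_fin_numE ?leb_outer_ge0// ltey; apply/eqP/Aoo.
  by exists F; split => //; exact: ltW.
pose v (p : nat * nat) := (box_vol S (G p.1 p.2))%:E.
have v_ge0 p : 0 <= v p by rewrite lee_fin box_vol_ge0//; exact: (PG _).1.1.
apply: (@le_trans _ _ (\esum_(i in setT) v i)).
  rewrite leb_outerE; apply: ereal_inf_lbound => /=.
  have /card_esym/ppcard_eqP[f] := card_nat2.
  exists (fun k => G (f k).1 (f k).2).
    split => [k|]; first exact: (PG _).1.1.
    move=> t [[i _ Ait] St].
    have [j _ Bijt] := (PG i).1.2 t (conj Ait St).
    by exists (f^-1%FUN (i, j)) => //=; rewrite invK ?inE.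
  rewrite -(esum_pred_image v _ xpredT) ?[fun=> _]set_true//.
  by rewrite image_eq.
rewrite (_ : esum _ _ = \sum_(i <oo) \sum_(j <oo ) v (i, j)); last first.
  pose J : nat -> set (nat * nat) := fun i => [set (i, j) | j in setT].
  rewrite (_ : setT = \bigcup_k J k); last first.
    by rewrite predeqE => -[a b]; split => // _; exists a => //; exists b.
  rewrite esum_bigcupT//=; last first.
    apply/trivIsetP => i j _ _ ij.
    rewrite predeqE => -[n m] /=; split => //= -[] [_] _ [<-{n} _].
    by move=> [m' _] [] /esym/eqP; rewrite (negbTE ij).
  rewrite -(image_id [set: nat]) -fun_true esum_pred_image//; last first.
    by move=> n _; exact: esum_ge0.
  apply: eq_eseriesr => /= j _.
  rewrite -(esum_pred_image v (pair j) predT)//=; last first.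
    by move=> ? ? _ _; exact: (@can_inj _ _ _ snd).
  by congr esum; rewrite predeqE => -[a b]; split; move=> [i _ <-]; exists i.
apply: lee_nneseries => [i _ _|i _]; first exact: nneseries_ge0.
exact: (PG i).2.
Qed.

HB.instance Definition _ := isOuterMeasure.Build R rV (@leb_outer R N S)
  leb_outer0 leb_outer_ge0 le_leb_outer leb_outer_sigma_subadditive.

(** Covers see only the trace on the plane. This is what lets a measure on all of R^N stand for the
    measure of the plane. *)
Lemma leb_outer_setC_plane : leb_outer S (~` coord_plane S : set rV) = 0.
Proof.
apply/eqP; rewrite eq_le leb_outer_ge0 andbT -leb_outer0.
by apply: le_leb_outer_plane => x [].
Qed.

(** The two halves of a box cut along x_i = a. A half with reversed endpoints would not be valid, so
    it becomes the empty cover element [None]. *)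
Let lower_box i (a : R) o := if o is Some (l, u) then
  if (a < l ord0 i)%R then None
  else Some (l, set_coord i u (Num.min (u ord0 i) a)) else None.

Let upper_box i (a : R) o := if o is Some (l, u) then
  if (u ord0 i < a)%R then None
  else Some (set_coord i l (Num.max (l ord0 i) a), u) else None.

Let valid_lower_box i a o : valid_box o -> valid_box (lower_box i a o).
Proof.
case: o => [[l u]|//] /(_ _ erefl)/= lu ab /=; case: ltP => // al [<-] k /=.
by rewrite set_coordE; case: eqVneq => // ->; rewrite le_min lu.
Qed.

Let valid_upper_box i a o : valid_box o -> valid_box (upper_box i a o).
Proof.
case: o => [[l u]|//] /(_ _ erefl)/= lu ab /=; case: ltP => // al [<-] k /=.
by rewrite set_coordE; case: eqVneq => // ->; rewrite ge_max lu.
Qed.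

Let box_vol_split i a o : S i -> valid_box o ->
  (box_vol S (lower_box i a o) + box_vol S (upper_box i a o) = box_vol S o)%R.
Proof.
move=> Si; case: o => [[l u]|_] /=; last by rewrite addr0.
move=> /(_ _ erefl)/= lu.
have E (l' u' : rV) : box_vol S (Some (l', u')) = ((u' ord0 i - l' ord0 i) *
    \prod_(k < N | S k && (k != i)) (u' ord0 k - l' ord0 k))%R.
  by rewrite /= (bigD1 i).
have E1 (w : rV) b :
  (\prod_(k < N | S k && (k != i)) (set_coord i w b ord0 k - l ord0 k) =
   \prod_(k < N | S k && (k != i)) (w ord0 k - l ord0 k))%R.
  by apply: eq_bigr => k /andP[_ /negbTE ki]; rewrite set_coordE ki.
have E2 (w : rV) b :
  (\prod_(k < N | S k && (k != i)) (u ord0 k - set_coord i w b ord0 k) =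
   \prod_(k < N | S k && (k != i)) (u ord0 k - w ord0 k))%R.
  by apply: eq_bigr => k /andP[_ /negbTE ki]; rewrite set_coordE ki.
rewrite -[RHS]/(box_vol S (Some (l, u))).
case: ltP => al; case: ltP => ua.
- by have := lt_trans ua al; rewrite ltNge lu.
- by rewrite add0r !E E2 set_coordE eqxx.
- by rewrite addr0 !E E1 set_coordE eqxx.
- by rewrite !E E1 E2 !set_coordE eqxx -mulrDl addrC addrA subrK.
Qed.

Let box_set_lower i a o x : S i -> box_set S o x -> (x ord0 i <= a)%R ->
  box_set S (lower_box i a o) x.
Proof.
move=> Si; case: o => [[l u]|//] /= h xa; case: ifPn => [al|_ k Sk].
  by have /andP[/(lt_le_trans al)] := h _ Si; rewrite ltNge xa.
by rewrite set_coordE; case: eqVneq => [->|_]; rewrite ?le_min ?xa ?andbT h.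
Qed.

Let box_set_upper i a o x : S i -> box_set S o x -> (a <= x ord0 i)%R ->
  box_set S (upper_box i a o) x.
Proof.
move=> Si; case: o => [[l u]|//] /= h xa; case: ifPn => [al|_ k Sk].
  by have /andP[_ /le_lt_trans/(_ al)] := h _ Si; rewrite ltNge xa.
rewrite set_coordE; case: eqVneq => [->|_]; last exact: h.
by rewrite ge_max xa andbT h.
Qed.

(** Cutting every box of a cover along x_i = a yields covers of both pieces without changing the
    total volume. *)
Lemma caratheodory_halfspace i (a : R) :
  (@leb_outer R N S).-caratheodory [set x : rV | (a < x ord0 i)%R].
Proof.
apply: le_caratheodory_measurable => X.
(* For i outside [S] the plane satisfies x_i = 0, so it lies entirely on one side of the cut. *)
have [Si|Si] := boolP (S i); last first.
  have null B : B `&` coord_plane S `<=` set0 -> leb_outer S B = 0.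
    move=> B0; apply/eqP; rewrite eq_le leb_outer_ge0 andbT -leb_outer0.
    exact: le_leb_outer_plane.
  have [a0|a0] := ltP a (0 : R)%R.
    rewrite [X in _ + X]null ?adde0; first by apply: le_leb_outer => x [].
    by move=> x [[_ /= ax] /(_ _ Si) xi]; apply: ax; rewrite xi.
  rewrite [X in X + _]null ?add0e; first by apply: le_leb_outer => x [].
  by move=> x [[_ /= ax] /(_ _ Si) xi]; move: ax; rewrite xi ltNge a0.
rewrite [leRHS]leb_outerE; apply: le_ereal_inf_tmp => _ [F [vF XF] <-].
rewrite addeC; apply: (@le_trans _ _
  (\sum_(0 <= k <oo) (box_vol S (lower_box i a (F k)))%:E +
   \sum_(0 <= k <oo) (box_vol S (upper_box i a (F k)))%:E)).
  apply: leeD; apply: ereal_inf_lbound.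
    exists (fun k => lower_box i a (F k)) => //; split.
      by move=> k; apply: valid_lower_box.
    move=> x [[Xx /= ax] Px]; have [k _ Fkx] := XF _ (conj Xx Px).
    by exists k => //; apply: box_set_lower => //; rewrite leNgt; apply/negP.
  exists (fun k => upper_box i a (F k)) => //; split.
    by move=> k; apply: valid_upper_box.
  move=> x [[Xx /= ax] Px]; have [k _ Fkx] := XF _ (conj Xx Px).
  by exists k => //; apply: box_set_upper => //; exact: ltW.
rewrite -nneseriesD.
- by apply: lee_nneseries => [k _ _|k _];
    rewrite -EFinD lee_fin box_vol_split// box_vol_ge0.
- by move=> k _ _; rewrite lee_fin box_vol_ge0//; apply: valid_lower_box.
- by move=> k _ _; rewrite lee_fin box_vol_ge0//; apply: valid_upper_box.
Qed.

Lemma caratheodory_leb_null A : leb_outer S A = 0 ->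
  (@leb_outer R N S).-caratheodory A.
Proof.
move=> A0; apply: le_caratheodory_measurable => X.
rewrite [X in X + _](_ : _ = 0) ?add0e; first by apply: le_leb_outer => x [].
by apply/eqP; rewrite eq_le leb_outer_ge0 andbT -A0 le_leb_outer// => x [].
Qed.

End leb_outer.

Lemma measurable_fun_rays d (T : measurableType d) (R : realType) (h : T -> R) :
  (forall a, measurable [set z | a < h z]) -> measurable_fun setT h.
Proof.
move=> mh; apply: (measurability _ (RGenOInfty.measurableE R)).
move=> _ [_ [a ->] <-]; rewrite setTI (_ : _ @^-1` _ = [set z | a < h z])//.
by apply/seteqP; split => x /=; rewrite in_itv/= andbT.
Qed.

(** * Borel sets of R^N *)

Section borel_row_vectors.
Variables (R : realType) (N : nat).
Local Notation rV := 'rV[R]_N.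

Definition boxes : set (set rV) := [set A | exists ab, A = coord_box predT ab].

(** Unlike [lebType], this sigma-algebra does not depend on [S], so one Borel set can be measured by
    the measures of several coordinate planes. *)
Definition borelType := g_sigma_algebraType boxes.

Lemma coord_boxE (S : pred 'I_N) (ab : rV * rV) : coord_box S ab =
  \bigcap_(i in [set i | S i])
    ((fun x : rV => x ord0 i) @^-1` `[ab.1 ord0 i, ab.2 ord0 i]).
Proof. by apply/seteqP; split => x h i /h; rewrite /= in_itv. Qed.

Lemma measurable_coord_box d (T : measurableType d) (h : T -> rV)
    (S : pred 'I_N) (ab : rV * rV) :
  (forall i, measurable_fun setT (fun z => h z ord0 i)) ->
  measurable (h @^-1` coord_box S ab).
Proof.
move=> mh; rewrite coord_boxE preimage_bigcap.
apply: fin_bigcap_measurable => [|i _]; first exact: finite_finset.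
by rewrite -[X in measurable X]setTI; apply: mh.
Qed.

Lemma measurable_fun_rV d (T : measurableType d) (h : T -> rV) :
  (forall i, measurable_fun setT (fun z => h z ord0 i)) ->
  measurable_fun setT (h : T -> borelType).
Proof.
move=> mh; apply: (@measurability _ _ T borelType setT h boxes erefl).
by move=> _ [_ [ab ->] <-]; rewrite setTI; exact: measurable_coord_box.
Qed.

Lemma measurable_fun_coord (i : 'I_N) :
  measurable_fun setT (fun x : borelType => (x : rV) ord0 i).
Proof.
apply: measurable_fun_rays => a; rewrite -[X in measurable X]setCK.
apply: measurableC.
(* The closed half-space x_i <= a is the union of the cubes [-n, n]^N with the i-th upper end
   replaced by a; some of these boxes may be empty. *)
pose l n : rV := \row_k (- n%:R).
pose u n : rV := set_coord i (\row_k n%:R) a.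
rewrite (_ : ~` _ = \bigcup_n (coord_box predT (l n, u n))); last first.
  apply/seteqP; split => [x /= /negP|x [n _ /(_ i isT)/=]]; last first.
    by rewrite set_coordE eqxx => /andP[_]; rewrite leNgt => /negP.
  rewrite -leNgt => xa; exists (coord_bound x) => // k _.
  have := norm_coord_le x k; rewrite /l /u /= set_coordE !mxE; case: eqVneq => [->|_].
    by rewrite ler_norml xa andbT => /andP[].
  by rewrite ler_norml.
apply: bigcupT_measurable => n; apply: sub_sigma_algebra.
by exists (l n, u n).
Qed.

End borel_row_vectors.

(** * Lebesgue measures on the Borel sets and on their completion *)

Section leb_measures.
Variables (R : realType) (N : nat) (S : pred 'I_N).
Local Notation rV := 'rV[R]_N.
Local Open Scope ereal_scope.

Let cara := caratheodory_type (@leb_outer R N S).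

Let caratheodory_box (ab : rV * rV) :
  (@leb_outer R N S).-caratheodory (coord_box predT ab).
Proof.
have := @measurable_coord_box _ _ _ cara id predT ab.
by apply => i; apply: measurable_fun_rays => a; exact: caratheodory_halfspace.
Qed.

Lemma caratheodory_borel (A : set (borelType R N)) : measurable A ->
  (@leb_outer R N S).-caratheodory A.
Proof.
move: A; apply: smallest_sub; first exact: (sigma_algebra_measurable cara).
by move=> _ [ab ->]; exact: caratheodory_box.
Qed.

Lemma caratheodory_lebesgue (A : set (@lebType R N S)) : measurable A ->
  (@leb_outer R N S).-caratheodory A.
Proof.
move: A; apply: smallest_sub; first exact: (sigma_algebra_measurable cara).
move=> A [[ab ->]|]; first exact: caratheodory_box.
exact: caratheodory_leb_null.
Qed.

(** The same set function on two sigma-algebras: [leb_borel] is used for products and sections,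
    [leb] is the measure of the theorem up to a constant. *)
Definition leb_borel : set (borelType R N) -> \bar R := leb_outer S.
Definition leb : set (@lebType R N S) -> \bar R := leb_outer S.

Let leb_borel_additive : semi_sigma_additive leb_borel.
Proof.
move=> F mF tF mUF.
apply: (@caratheodory_measure_sigma_additive R rV (@leb_outer R N S) F) => //.
- by move=> i; exact: caratheodory_borel.
- exact: caratheodory_borel.
Qed.

HB.instance Definition _ := isMeasure.Build _ _ _ leb_borel
  (@leb_outer0 R N S) (@leb_outer_ge0 R N S) leb_borel_additive.

Let leb_additive : semi_sigma_additive leb.
Proof.
move=> F mF tF mUF.
apply: (@caratheodory_measure_sigma_additive R rV (@leb_outer R N S) F) => //.
- by move=> i; exact: caratheodory_lebesgue.
- exact: caratheodory_lebesgue.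
Qed.

HB.instance Definition _ := isMeasure.Build _ _ _ leb
  (@leb_outer0 R N S) (@leb_outer_ge0 R N S) leb_additive.

End leb_measures.

(** * Volumes of boxes, slicing and shears *)

Section box_measures.
Variables (R : realType) (N : nat).
Local Notation rV := 'rV[R]_N.
Local Notation borel := (borelType R N).
Local Notation leb_borel := (@leb_borel R N).
Local Open Scope ereal_scope.

Lemma borel_coord_box (S : pred 'I_N) (ab : rV * rV) :
  measurable (coord_box S ab : set borel).
Proof.
exact: (@measurable_coord_box _ _ _ borel id S ab (@measurable_fun_coord R N)).
Qed.

Lemma borel_coord_plane (S : pred 'I_N) :
  measurable (coord_plane S : set borel).
Proof.
(* The plane is the degenerate box [0, 0] in the directions outside [S]. *)
rewrite (_ : coord_plane S = coord_box (predC S) (0%R, 0%R)).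
  exact: borel_coord_box.
apply/seteqP; split => x h i; first by move=> /h ->; rewrite mxE lexx.
by move=> /h; rewrite !mxE -eq_le => /eqP.
Qed.

Lemma sigma_finite_leb_borel (S : pred 'I_N) :
  sigma_finite [set: borel] (leb_borel S).
Proof.
pose M n : rV := (\row_k n%:R)%R.
exists (fun n => coord_box predT (- M n, M n)%R).
  apply/seteqP; split => // x _; exists (coord_bound x) => // k _ /=.
  by rewrite !mxE -ler_norml norm_coord_le.
move=> n; split; first exact: borel_coord_box.
apply: (@le_lt_trans _ _ (leb_outer S (coord_box S (- M n, M n)%R))).
  by apply: le_leb_outer => x h i _; exact: h.
apply: le_lt_trans (leb_outer_box _ _) (ltry _) => i /=.
by rewrite !mxE; apply: (@le_trans _ _ 0%R); rewrite // oppr_le0.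
Qed.

HB.instance Definition _ (S : pred 'I_N) :=
  Measure_isSigmaFinite.Build _ _ _ (leb_borel S) (@sigma_finite_leb_borel S).

Section concentrated_measures.
Variables (S : pred 'I_N) (m : {measure set borel -> \bar R}).
Hypothesis m_plane : m (~` coord_plane S) = 0.

Lemma measureI_plane (A : set borel) : measurable A ->
  m A = m (A `&` coord_plane S).
Proof.
move=> mA; have mP := borel_coord_plane S.
rewrite [LHS](measureDI m mA mP) [X in X + _](_ : _ = 0) ?add0e//.
apply/eqP; rewrite eq_le measure_ge0 andbT -m_plane.
apply: le_measure; rewrite ?inE.
- exact: measurableD.
- exact: measurableC.
- by move=> x [].
Qed.

Lemma eq_measure_plane (A B : set borel) : measurable A -> measurable B ->
  A `&` coord_plane S = B `&` coord_plane S -> m A = m B.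
Proof. by move=> mA mB AB; rewrite measureI_plane// AB -measureI_plane. Qed.

(** Countable subadditivity of [m] along an arbitrary cover. Any such measure is a lower bound for
    the infimum over covers. *)
Lemma le_measure_leb_outer :
  (forall ab : rV * rV, (forall i, ab.1 ord0 i <= ab.2 ord0 i)%R ->
    m (coord_box S ab) <= (box_vol S (Some ab))%:E) ->
  forall A : set borel, measurable A -> m A <= leb_outer S A.
Proof.
move=> mbox A mA; rewrite leb_outerE.
apply: le_ereal_inf_tmp => _ [F [vF AF] <-].
have mF k : measurable (box_set S (F k) : set borel).
  by case: (F k) => [ab|] //=; exact: borel_coord_box.
rewrite measureI_plane//.
have mAP : measurable (A `&` coord_plane S : set borel).
  by apply: measurableI => //; exact: borel_coord_plane.
have := measure_sigma_subadditive m mF mAP AF; move=> /le_trans; apply.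
apply: lee_nneseries => [k _ _|k _]; first exact: measure_ge0.
move: (vF k); case: (F k) => [ab|] /= vab; last by rewrite measure0.
by apply: mbox; exact: vab.
Qed.

End concentrated_measures.

(** Full-dimensional boxes form an intersection-stable generator exhausted by cubes, but the
    hypotheses speak of boxes in the directions of [S]. Concentration bridges the gap: a nonempty
    full box meets the plane like an [S]-box if 0 lies in each remaining interval, and not at all
    otherwise. *)
Lemma eq_box_measures (S : pred 'I_N) (m1 m2 : {measure set borel -> \bar R}) :
  m1 (~` coord_plane S) = 0 -> m2 (~` coord_plane S) = 0 ->
  (forall ab : rV * rV, (forall i, ab.1 ord0 i <= ab.2 ord0 i)%R ->
    m1 (coord_box S ab) = (box_vol S (Some ab))%:E) ->
  (forall ab : rV * rV, (forall i, ab.1 ord0 i <= ab.2 ord0 i)%R ->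
    m2 (coord_box S ab) = (box_vol S (Some ab))%:E) ->
  forall A, measurable A -> m1 A = m2 A.
Proof.
move=> m1P m2P m1S m2S.
have val (m : {measure set borel -> \bar R}) : m (~` coord_plane S) = 0 ->
    (forall ab : rV * rV, (forall i, ab.1 ord0 i <= ab.2 ord0 i)%R ->
      m (coord_box S ab) = (box_vol S (Some ab))%:E) ->
    forall ab : rV * rV, m (coord_box predT ab) =
      if [forall i, (ab.1 ord0 i <= ab.2 ord0 i)%R] &&
         [forall i, S i || (ab.1 ord0 i <= 0 <= ab.2 ord0 i)%R]
      then (box_vol S (Some ab))%:E else 0.
  move=> mP mS ab; case: ifPn => [/andP[/forallP v /forallP v0]|].
    rewrite -mS//; apply: (eq_measure_plane mP); [exact: borel_coord_box..|].
    apply/seteqP; split => x [xb xP]; split => // i; first by move=> _; exact: xb.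
    have [/xb//|Si _] := boolP (S i).
    by rewrite (xP _ Si); have := v0 i; rewrite (negbTE Si).
  rewrite negb_and => h; rewrite -(measure0 m).
  apply: (eq_measure_plane mP); [exact: borel_coord_box|by []|].
  rewrite set0I -subset0 => x [xb xP].
  case/orP: h => /forallPn[i].
    by move=> /negP; apply; have /andP[] := xb i isT; exact: le_trans.
  by rewrite negb_or => /andP[Si] /negP; apply; rewrite -(xP _ Si); exact: xb.
pose M n : rV := (\row_k n%:R)%R.
apply: (@measure_unique _ R borel (@boxes R N)
  (fun n => coord_box predT (- M n, M n)%R)) => //.
- move=> _ _ [ab ->] [cd ->].
  exists ((\row_i Num.max (ab.1 ord0 i) (cd.1 ord0 i))%R,
          (\row_i Num.min (ab.2 ord0 i) (cd.2 ord0 i))%R).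
  apply/seteqP; split => x /=.
    move=> [h1 h2] i _ /=; rewrite !mxE ge_max le_min.
    by have /andP[-> ->] := h1 i isT; have /andP[-> ->] := h2 i isT.
  move=> h; split=> i _; have := h i isT; rewrite /= !mxE ge_max le_min.
    by move=> /andP[/andP[-> _] /andP[-> _]].
  by move=> /andP[/andP[_ ->] /andP[_ ->]].
- by move=> n; exists (- M n, M n)%R.
- apply/seteqP; split => // x _; exists (coord_bound x) => // k _ /=.
  by rewrite !mxE -ler_norml norm_coord_le.
- by move=> _ [ab ->]; rewrite !val.
- by move=> n; rewrite val//; case: ifP => // _; rewrite ltry.
Qed.

(** The first factor stays all of R^N and its i-th coordinate is overwritten, which spares an
    identification with R^(N-1). *)
Definition insert_coord (i : 'I_N) (z : borel * measurableTypeR R) : borel :=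
  set_coord i z.1 z.2.

Lemma measurable_insert_coord i : measurable_fun setT (insert_coord i).
Proof.
apply: measurable_fun_rV => k; rewrite /insert_coord.
under eq_fun do rewrite set_coordE.
case: (k == i); first exact: measurable_snd.
by apply: (measurableT_comp (measurable_fun_coord k)); exact: measurable_fst.
Qed.

Lemma insert_coord_box (S : pred 'I_N) i (ab : rV * rV) : S i ->
  insert_coord i @^-1` coord_box S ab =
  coord_box [pred k | S k && (k != i)] ab `*` `[ab.1 ord0 i, ab.2 ord0 i].
Proof.
move=> Si; apply/seteqP; split => -[x t] /=.
  move=> h; split => [k /andP[Sk ki]|] /=.
    by have := h _ Sk; rewrite set_coordE (negbTE ki).
  by have := h _ Si; rewrite set_coordE eqxx in_itv.
move=> [h]; rewrite in_itv/= => ti k Sk.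
rewrite set_coordE; case: eqVneq => [->//|ki].
by apply: h; rewrite /= Sk.
Qed.

(** The candidate for [leb_borel S] built from one dimension less: the image of the product measure
    under insertion of the i-th coordinate. *)
Definition slice_measure (S : pred 'I_N) (i : 'I_N) :
    {measure set borel -> \bar R} :=
  measure_function_pushforward__canonical__measure_function_Measure
    (leb_borel [pred k | S k && (k != i)] \x @lebesgue_measure R)
    (@measurable_insert_coord i).

Lemma slice_measureE (S : pred 'I_N) i (A : set borel) : slice_measure S i A =
  (leb_borel [pred k | S k && (k != i)] \x @lebesgue_measure R)
    (insert_coord i @^-1` A).
Proof. by []. Qed.

Lemma slice_measure_plane (S : pred 'I_N) i :
  S i -> slice_measure S i (~` coord_plane S) = 0.
Proof.
move=> Si; set S' : pred 'I_N := [pred k | S k && (k != i)].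
have mP := borel_coord_plane S'.
have mX : measurable ((~` coord_plane S' : set borel) `*`
    ([set: measurableTypeR R])).
  by apply: measurableX => //; exact: measurableC.
apply/eqP; rewrite eq_le measure_ge0 andbT slice_measureE.
apply: (@le_trans _ _ ((leb_borel S' \x @lebesgue_measure R)
    ((~` coord_plane S') `*` setT))).
  apply: le_measure; rewrite ?inE//.
    rewrite -[X in measurable X]setTI; apply: measurable_insert_coord => //.
    by apply: measurableC; exact: borel_coord_plane.
  move=> [x t] /= xP; split => // x0; apply: xP => k Sk.
  rewrite set_coordE; case: eqVneq => [ki|_]; first by rewrite ki Si in Sk.
  by apply: x0; rewrite /S' /= (negbTE Sk).
rewrite product_measure1E//; last exact: measurableC.
by rewrite [X in X * _](leb_outer_setC_plane R S') mul0e.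
Qed.

Lemma slice_measure_box (S : pred 'I_N) i (ab : rV * rV)
    (S' : pred 'I_N := [pred k | S k && (k != i)]) :
  S i -> (forall i, ab.1 ord0 i <= ab.2 ord0 i)%R ->
  leb_borel S' (coord_box S' ab) = (box_vol S' (Some ab))%:E ->
  slice_measure S i (coord_box S ab) = (box_vol S (Some ab))%:E.
Proof.
move=> Si vab vol'; rewrite slice_measureE insert_coord_box//.
rewrite product_measure1E//; last exact: borel_coord_box.
rewrite [X in X * _]vol' [X in _ * X]lebesgue_measure_itv /= lte_fin -EFinD.
rewrite [in RHS](bigD1 i)//=; case: ltP => h; first by rewrite -EFinM mulrC.
rewrite mule0 (_ : _ - _ = 0)%R ?mul0r//.
by apply/eqP; rewrite subr_eq0 eq_le h vab.
Qed.

(* Covers only bound the measure of a box from above. The lower bound comes from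
   comparison with the product measure provided by the induction hypothesis,
   which replaces the usual compactness argument. *)
Lemma leb_borel_box (S : pred 'I_N) (ab : rV * rV) :
  (forall i, ab.1 ord0 i <= ab.2 ord0 i)%R ->
  leb_borel S (coord_box S ab) = (box_vol S (Some ab))%:E.
Proof.
have [n] := ubnP #|S|; elim: n => // n IH in S ab *; rewrite ltnS => Sn vab.
suff [m [mP mbox]] : exists m : {measure set borel -> \bar R},
    m (~` coord_plane S) = 0 /\
    forall ab : rV * rV, (forall i, ab.1 ord0 i <= ab.2 ord0 i)%R ->
      m (coord_box S ab) = (box_vol S (Some ab))%:E.
  apply/eqP; rewrite eq_le leb_outer_box//= -[X in X <= _]mbox//.
  apply: (le_measure_leb_outer mP); last exact: borel_coord_box.
  by move=> cd vcd; rewrite mbox.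
(* For empty [S] the plane is the origin and every box has volume 1, the empty product; the
   comparison measure is the Dirac mass at 0. *)
have [i Si|S0] := pickP S; last first.
  exists (dirac (0%R : borel)); split => [|cd _]; rewrite [LHS]diracE.
    by rewrite memNset//= => h; apply: h => i _; rewrite mxE.
  by rewrite mem_set//=; [rewrite big_pred0|move=> i; rewrite S0].
exists (slice_measure S i); split; first exact: slice_measure_plane.
move=> cd vcd; apply: slice_measure_box => //; apply: IH => //.
move: Sn; rewrite (cardD1 i S) [i \in S]Si add1n; apply: leq_trans.
by rewrite ltnS; apply/subset_leq_card/fintype.subsetP => k; rewrite !inE andbC.
Qed.

(* Both sides are concentrated on [coord_plane S] and agree on boxes. *)
Lemma leb_borel_slice (S : pred 'I_N) i (A : set borel) : S i -> measurable A ->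
  leb_borel S A = (leb_borel [pred k | S k && (k != i)] \x @lebesgue_measure R)
    (insert_coord i @^-1` A).
Proof.
move=> Si mA; rewrite -slice_measureE; move: A mA; apply: (@eq_box_measures S).
- exact: leb_outer_setC_plane.
- exact: slice_measure_plane.
- exact: leb_borel_box.
- by move=> ab vab; apply: slice_measure_box => //; exact: leb_borel_box.
Qed.

(** The translated measure has the right value on half-open intervals, which determine Lebesgue
    measure. *)
Lemma lebesgue_measure_shift (a : R) (A : set (measurableTypeR R)) :
  measurable A -> lebesgue_measure [set t | A (t + a)%R] = lebesgue_measure A.
Proof.
move=> mA; pose s (t : measurableTypeR R) : measurableTypeR R := (t + a)%R.
have ms : measurable_fun setT s by apply: measurable_funD.
apply/esym.
rewrite (@lebesgue_measure_unique R
  (measure_function_pushforward__canonical__measure_function_Measure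
    (@lebesgue_measure R) ms))// => _ [[b c] _ <-].
rewrite /= /pushforward (_ : s @^-1` _ = `](b - a)%R, (c - a)%R]%classic).
  by rewrite !lebesgue_measure_itv/= !lte_fin ltrD2r -!EFinD opprB addrA subrK.
by apply/seteqP; split => t /=; rewrite !in_itv/= ltrBlDr lerBrDr.
Qed.

Lemma leb_borel_shear (S : pred 'I_N) i (P : borel -> R) (A : set borel) : S i ->
  measurable_fun setT P -> (forall x t, P (set_coord i x t) = P x) ->
  measurable A ->
  leb_borel S [set x | A (set_coord i x ((x : rV) ord0 i + P x)%R)] =
  leb_borel S A.
Proof.
move=> Si mP Pi mA.
set T := fun x : borel => set_coord i x ((x : rV) ord0 i + P x)%R.
have mT : measurable_fun setT (T : borel -> borel).
  apply: measurable_fun_rV => k; under eq_fun do rewrite set_coordE.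
  case: (k == i); last exact: measurable_fun_coord.
  by apply: measurable_funD => //; exact: measurable_fun_coord.
rewrite !(@leb_borel_slice S i)//; last first.
  by rewrite -[X in measurable X]setTI; exact: mT.
apply: eq_integral => x _ /=.
rewrite -[RHS](@lebesgue_measure_shift (P x)); last first.
  apply: measurable_xsection.
  by rewrite -[X in measurable X]setTI; exact: measurable_insert_coord.
congr lebesgue_measure; apply/seteqP.
(* Since P ignores the i-th coordinate, the shear acts on the line through x in direction i as the
   translation by the constant P x. *)
have E t : T (set_coord i x t) = set_coord i x (t + P x)%R.
  apply/rowP => k; rewrite !set_coordE Pi; case: eqVneq => // _.
  by rewrite eqxx.
by split => t; rewrite /xsection /= !inE /= /insert_coord /= -E.
Qed.

End box_measures.

(** * Triangular maps preserve Lebesgue measure *)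

Section triangular.
Variables (R : realType) (N : nat).
Local Notation rV := 'rV[R]_N.
Local Notation borel := (borelType R N).

Lemma leb_borel_triangular (Q : 'I_N -> borel -> R) (A : set borel) :
  (forall i, measurable_fun setT (Q i)) ->
  (forall (i : 'I_N) (x y : rV),
    (forall k : 'I_N, (k < i)%N -> x ord0 k = y ord0 k) -> Q i x = Q i y) ->
  measurable A ->
  @leb_borel R N predT [set x | A (\row_i ((x : rV) ord0 i + Q i x))] =
  @leb_borel R N predT A.
Proof.
move=> mQ Qlow mA.
(* [Psi m] moves only the coordinates of index below m, so it interpolates between the identity and
   the full map. *)
pose Psi m (x : borel) : borel :=
  \row_(i < N) ((x : rV) ord0 i + if (i < m)%N then Q i x else 0).
have mPsi m : measurable_fun setT (Psi m).
  apply: measurable_fun_rV => k; under eq_fun do rewrite mxE.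
  apply: measurable_funD; first exact: measurable_fun_coord.
  by case: (k < m)%N; [exact: mQ|exact: measurable_cst].
have Psi_preserves m : (m <= N)%N ->
    @leb_borel R N predT (Psi m @^-1` A) = @leb_borel R N predT A.
  elim: m => [_|m IH mN].
    suff E x : Psi 0%N x = x.
      by congr (@leb_borel R N predT _); apply/seteqP; split => x /=; rewrite E.
    by apply/rowP => k; rewrite mxE addr0.
  rewrite -IH; last exact: ltnW.
  rewrite -[RHS](@leb_borel_shear R N predT (Ordinal mN) (Q (Ordinal mN)))//.
  (* The shear in coordinate m acts before [Psi m]. In this order every [Q i] is evaluated at the
     original coordinates, because those with i < m do not see coordinate m. *)
  - suff E (x : rV) : Psi m (set_coord (Ordinal mN) x
        (x ord0 (Ordinal mN) + Q (Ordinal mN) x)) = Psi m.+1 x.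
      by congr (@leb_borel R N predT _); apply/seteqP; split => x /=; rewrite E.
    apply/rowP => k; rewrite !mxE; case: eqVneq => [->|km] /=.
      by rewrite ltnn ltnSn addr0.
    have {}km : k != m :> nat by [].
    rewrite ltnS (leq_eqVlt k m) (negbTE km) /=.
    case: ifP => // lkm; congr (_ + _); apply: Qlow => l lk.
    by rewrite set_coordE -val_eqE /= ltn_eqF// (ltn_trans lk).
  - move=> x t; apply: Qlow => k km; rewrite set_coordE.
    by rewrite -val_eqE /= ltn_eqF.
  - by rewrite -[X in measurable X]setTI; exact: mPsi.
rewrite -[RHS](Psi_preserves N)//.
suff E (x : rV) : Psi N x = \row_i (x ord0 i + Q i x).
  by congr (@leb_borel R N predT _); apply/seteqP; split => x /=; rewrite E.
by apply/rowP => k; rewrite !mxE ltn_ord.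
Qed.

End triangular.

Lemma measurable_rsum d (T : measurableType d) (R : realType) (I : Type)
    (s : seq I) (h : I -> T -> R) :
  (forall i, measurable_fun setT (h i)) ->
  measurable_fun setT (fun x => \sum_(i <- s) h i x).
Proof.
move=> mh; elim: s => [|i s IH].
  by under eq_fun do rewrite big_nil; exact: measurable_cst.
by under eq_fun do rewrite big_cons; exact: measurable_funD.
Qed.

(** * Grading of the bracket and triangularity of the BCH series *)

Section bch.
Variables (R : realType) (N : nat).
Local Notation rV := 'rV[R]_N.
Variables (c : 'I_N -> 'I_N -> 'I_N -> R) (sigma : 'I_N -> nat).
Implicit Types x y z : rV.

Lemma lie_br0l z : lie_br c 0 z = 0.
Proof.
apply/rowP => k; rewrite !mxE big1// => a _; rewrite big1// => b _.
by rewrite mxE !mul0r.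
Qed.

Lemma lie_brDl z : {morph (lie_br c)^~ z : x y / x + y}.
Proof.
move=> x y; apply/rowP => k; rewrite !mxE -big_split; apply: eq_bigr => a _.
by rewrite -big_split; apply: eq_bigr => b _; rewrite !mxE !mulrDl.
Qed.

Lemma lie_brZl z t x : lie_br c (t *: x) z = t *: lie_br c x z.
Proof.
apply/rowP => k; rewrite !mxE mulr_sumr; apply: eq_bigr => a _.
by rewrite mulr_sumr; apply: eq_bigr => b _; rewrite !mxE !mulrA.
Qed.

Lemma lie_br_ebasis (a b k : 'I_N) :
  lie_br c (ebasis R a) (ebasis R b) ord0 k = c a b k.
Proof.
rewrite mxE (bigD1 a)//= (bigD1 b)//= !mxE !eqxx !mul1r big1 => [|b' /negbTE bb].
  rewrite addr0 big1 ?addr0// => a' /negbTE aa; rewrite big1// => b' _.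
  by rewrite !mxE aa !mul0r.
by rewrite !mxE bb mulr0 mul0r.
Qed.

(** Membership in V_d read off the coordinates; the zero vector belongs to every degree. *)
Let homog d x := forall k, x ord0 k != 0 -> sigma k = d.

Let homog_lie_br d x y :
  (forall a b k, x ord0 a != 0 -> y ord0 b != 0 -> c a b k != 0 -> sigma k = d) ->
  homog d (lie_br c x y).
Proof.
move=> h k; apply: contraNeq => kd; rewrite mxE.
apply/eqP/big1 => a _; apply: big1 => b _; apply/eqP.
apply: contraNT kd; rewrite !mulf_eq0 !negb_or => /andP[/andP[xa yb] ck].
exact/eqP/(h a b).
Qed.

Let ebasis_neq0 (a k : 'I_N) : ebasis R a ord0 k != 0 -> k = a.
Proof. by rewrite mxE; case: (eqVneq k a) => [//|]; rewrite eqxx. Qed.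

Let homogD d x y : homog d x -> homog d y -> homog d (x + y).
Proof.
move=> hx hy k; rewrite mxE; have [->|/hx//] := eqVneq (x ord0 k) 0.
by rewrite add0r => /hy.
Qed.

Let homogZ d t x : homog d x -> homog d (t *: x).
Proof. by move=> hx k; rewrite mxE mulf_eq0 negb_or => /andP[_ /hx]. Qed.

Hypothesis carnot : carnot_algebra c sigma.

Lemma lie_brC x y : lie_br c x y = - lie_br c y x.
Proof.
have [anti _ _ _ _] := carnot; apply/rowP => k; rewrite !mxE exchange_big/=.
rewrite -sumrN; apply: eq_bigr => b _; rewrite -sumrN; apply: eq_bigr => a _.
by rewrite anti mulrN (mulrC (x ord0 a)).
Qed.

(* The stratification hypothesis only speaks of brackets with V_1; the other
   ones follow from the Jacobi identity, as V_1 generates the algebra. *)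
Lemma carnot_grading a b k : c a b k != 0 -> sigma k = (sigma a + sigma b)%N.
Proof.
have [_ jac [sigma_gt0 _] V1 gen] := carnot.
have [n] := ubnP (sigma a); elim: n => // n IH in a b k *; rewrite ltnS => an.
have [a1|a1] := eqVneq (sigma a) 1%N.
  by move=> /(V1 _ _ _ a1) ->; rewrite a1 add1n.
have {}a1 : (1 < sigma a)%N by rewrite ltn_neqAle eq_sym a1 sigma_gt0.
have [lam ea] := gen _ a1.
rewrite -lie_br_ebasis; move: k; rewrite -/(homog _ _) ea.
rewrite (big_morph _ (lie_brDl _) (lie_br0l _)).
have h0 d : homog d 0 by move=> k; rewrite mxE eqxx.
apply: (big_ind (homog _)) => [||u /eqP u1]; [exact: h0|exact: homogD|].
rewrite (big_morph _ (lie_brDl _) (lie_br0l _)).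
apply: (big_ind (homog _)) => [||v /eqP va]; [exact: h0|exact: homogD|].
rewrite lie_brZl; apply: homogZ.
set eu := ebasis R u; set ev := ebasis R v; set eb := ebasis R b.
(* Jacobi moves the outer bracket onto e_u, of degree one, and e_v, of degree one less than e_a,
   which the induction reaches. *)
have -> : lie_br c (lie_br c eu ev) eb =
    lie_br c eu (lie_br c ev eb) + lie_br c ev (lie_br c eb eu).
  by rewrite lie_brC; apply/eqP; rewrite eq_sym -addr_eq0 jac.
have vn : (sigma v < n)%N by rewrite (leq_trans _ an)// -va.
have ad : (sigma a + sigma b = (sigma v + sigma b).+1)%N by rewrite -va addSn.
rewrite ad; apply: homogD.
  apply: homog_lie_br => _ b' k /ebasis_neq0 -> hb' /(V1 _ _ _ u1) ->; congr _.+1.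
  apply: (homog_lie_br _ hb') => _ _ k' /ebasis_neq0 -> /ebasis_neq0 ->.
  exact: IH.
(* In [e_v, [e_b, e_u]] the induction hypothesis handles the outer bracket, and antisymmetry brings
   e_u to the left of the inner one. *)
apply: homog_lie_br => _ b' k /ebasis_neq0 -> hb' /(IH _ _ _ vn) ->.
rewrite -addnS; congr addn; move: hb'; rewrite lie_brC mxE oppr_eq0.
apply: homog_lie_br => _ _ k' /ebasis_neq0 -> /ebasis_neq0 ->.
exact: V1.
Qed.

(** Degrees are positive, so k has a strictly larger degree than a and b; the basis is ordered by
    degree, so its index is larger too. *)
Lemma carnot_index (a b k : 'I_N) : c a b k != 0 -> (a < k)%N /\ (b < k)%N.
Proof.
have [_ _ [sigma_gt0 sigma_nd] _ _] := carnot.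
move=> /carnot_grading kE; split; rewrite ltnNge; apply/negP => /sigma_nd.
  by rewrite kE -[X in (_ <= X)%N]addn0 leq_add2l leqNgt sigma_gt0.
by rewrite kE -[X in (_ <= X)%N]add0n leq_add2r leqNgt sigma_gt0.
Qed.

(** A bracket gains one index: agreement of the arguments strictly below m gives agreement up to and
    including m. *)
Lemma lie_br_low (m : nat) x x' y y' :
  (forall k : 'I_N, (k < m)%N -> x ord0 k = x' ord0 k) ->
  (forall k : 'I_N, (k < m)%N -> y ord0 k = y' ord0 k) ->
  forall k : 'I_N, (k <= m)%N -> lie_br c x y ord0 k = lie_br c x' y' ord0 k.
Proof.
move=> xx' yy' k km; rewrite !mxE; apply: eq_bigr => a _; apply: eq_bigr => b _.
have [->|/carnot_index[ak bk]] := eqVneq (c a b k) 0; first by rewrite !mulr0.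
by rewrite xx' ?(leq_trans ak)// yy' ?(leq_trans bk).
Qed.

(** The gain of one index occurs only if a bracket is really taken. The boolean [size w == 1],
    counted as 0 or 1, removes it for a single letter. *)
Lemma nest_br_low (m : nat) (T : Type) (w : seq T) (u u' : T -> rV) :
  (forall (z : T) (k : 'I_N), (k < m)%N -> u z ord0 k = u' z ord0 k) ->
  forall k : 'I_N, (k + (size w == 1) <= m)%N ->
  nest_br c (map u w) ord0 k = nest_br c (map u' w) ord0 k.
Proof.
move=> uu' k; elim: w k => [//|z [_ k|z' w IH k]].
  by rewrite addn1; exact: uu'.
rewrite addn0 => km; apply: (lie_br_low (uu' z)) km => l lm.
apply: IH; apply: leq_trans lm.
by rewrite -[X in (_ <= X)%N]addn1 leq_add2l leq_b1.
Qed.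

Lemma measurable_nest_br d (T : measurableType d) (I : Type) (w : seq I)
    (u : T -> I -> rV) :
  (forall (z : I) k, measurable_fun setT (fun p => u p z ord0 k)) ->
  forall k, measurable_fun setT (fun p => nest_br c (map (u p) w) ord0 k).
Proof.
move=> mu; elim: w => [k|z [_ k|z' w IH k]].
- by under eq_fun do rewrite mxE; exact: measurable_cst.
- exact: mu.
- under eq_fun do rewrite mxE.
  apply: measurable_rsum => a; apply: measurable_rsum => b.
  apply: measurable_funM; last exact: measurable_cst.
  by apply: measurable_funM; [exact: mu|exact: IH].
Qed.

(** Boolean letters, [true] for x and [false] for y, separate the word from the vectors, so that one
    word can be evaluated at two points or at a variable point. *)
Definition word n (r s : {ffun 'I_n.+1 -> 'I_N.+1}) : seq bool :=
  flatten [seq nseq (r i) true ++ nseq (s i) false | i <- enum 'I_n.+1].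

Lemma map_word n (r s : {ffun 'I_n.+1 -> 'I_N.+1}) x y :
  flatten [seq nseq (r i) x ++ nseq (s i) y | i <- enum 'I_n.+1] =
  map (fun b : bool => if b then x else y) (word r s).
Proof.
rewrite /word map_flatten -map_comp; congr flatten; apply: eq_map => i /=.
by rewrite map_cat !map_nseq.
Qed.

Lemma size_word n (r s : {ffun 'I_n.+1 -> 'I_N.+1}) :
  size (word r s) = (\sum_i (r i + s i))%N.
Proof.
rewrite /word size_flatten /shape -map_comp sumnE big_map big_enum/=.
by apply: eq_bigr => i _; rewrite size_cat !size_nseq.
Qed.

Definition bch_coef n (r s : {ffun 'I_n.+1 -> 'I_N.+1}) : R :=
  (-1) ^+ n / n.+1%:R
    / ((size (word r s))%:R * \prod_(i < n.+1) ((r i)`! * (s i)`!)%:R).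

(** The part of the BCH series whose word lengths satisfy P; it serves to separate the linear part
    from the rest. *)
Definition bch_sum (P : pred nat) x y : rV :=
  \sum_(n < N)
   \sum_(r : {ffun 'I_n.+1 -> 'I_N.+1})
    \sum_(s : {ffun 'I_n.+1 -> 'I_N.+1} | [forall i, (0 < r i + s i)%N])
      if P (size (word r s)) then
        bch_coef r s *:
          nest_br c (map (fun b : bool => if b then x else y) (word r s))
      else 0.

Lemma bch_split x y :
  bch c x y = bch_sum (pred1 1%N) x y + bch_sum (predC1 1%N) x y.
Proof.
rewrite /bch /bch_sum -big_split; apply: eq_bigr => n _.
rewrite -big_split; apply: eq_bigr => r _.
rewrite -big_split; apply: eq_bigr => s _ /=.
rewrite map_word size_map -/(bch_coef r s).
by case: eqP => _ /=; rewrite ?addr0 ?add0r.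
Qed.

(** Each of the n + 1 blocks of a word has at least one letter, so length one forces n = 0 and
    exponents (1, 0) or (0, 1), that is [f1], [f0] or [f0], [f1]. Both coefficients are 1. *)
Lemma bch_sum1 x y : (0 < N)%N -> bch_sum (pred1 1%N) x y = x + y.
Proof.
move=> N0; rewrite /bch_sum (bigD1 (Ordinal N0))//=.
rewrite [X in _ + X]big1 ?addr0; last first.
  move=> n n0; apply: big1 => r _; apply: big1 => s /forallP rs.
  case: ifP => // /eqP; rewrite size_word => sz.
  have : (\sum_(i < n.+1) 1 <= \sum_(i < n.+1) (r i + s i))%N by apply: leq_sum.
  rewrite sz sum1_card card_ord ltnS leqn0 => n0'.
  by move: n0; rewrite -val_eqE /= n0'.
have N1 : (1 < N.+1)%N by [].
have wE (r s : {ffun 'I_1 -> 'I_N.+1}) :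
    word r s = nseq (r ord0) true ++ nseq (s ord0) false.
  by rewrite /word enum_ordSl/= enum_ord0/= cats0.
pose f0 : {ffun 'I_1 -> 'I_N.+1} := [ffun=> ord0].
pose f1 : {ffun 'I_1 -> 'I_N.+1} := [ffun=> Ordinal N1].
have f0P (f : {ffun 'I_1 -> 'I_N.+1}) : f != f0 -> (0 < f ord0)%N.
  apply: contraNT; rewrite -eqn0Ngt => f00; apply/eqP/ffunP => i.
  by rewrite ffunE ord1; apply/val_inj/eqP.
have f1P (f : {ffun 'I_1 -> 'I_N.+1}) : f != f1 -> (f ord0 != 1 :> nat).
  apply: contraNneq => f01; apply/eqP/ffunP => i.
  by rewrite ffunE ord1; apply/val_inj.
have f01 : f0 != f1.
  by apply/eqP => /ffunP/(_ ord0)/eqP; rewrite !ffunE -val_eqE.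
have coef (r s : {ffun 'I_1 -> 'I_N.+1}) : (r ord0 <= 1)%N -> (s ord0 <= 1)%N ->
    size (word r s) = 1%N -> bch_coef r s = 1.
  move=> r1 s1 sz; rewrite /bch_coef sz big_ord1 expr0.
  have fact1 n : (n <= 1)%N -> n`! = 1%N by case: n => [|[]].
  by rewrite !fact1// mulr1 !divr1.
rewrite (bigD1 f1)//= [X in _ + X](bigD1 f0)//=.
rewrite [X in _ + (_ + X)]big1 ?addr0; last first.
  move=> r /andP[rf1 rf0]; apply: big1 => s _; case: ifP => //.
  rewrite size_word big_ord1 => /eqP sz.
  have := f0P _ rf0; have := f1P _ rf1; move: sz.
  by case: (nat_of_ord (r _)) => [|[]].
rewrite [X in X + _](bigD1 f0)/=; last by apply/forallP => i; rewrite !ffunE.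
rewrite [X in (_ + X) + _]big1 ?addr0; last first.
  move=> s /andP[_ sf0]; case: ifP => //.
  rewrite size_word big_ord1 ffunE /= => /eqP[]; rewrite add0n => s0.
  by have := f0P _ sf0; rewrite s0.
rewrite [X in _ + X](bigD1 f1)/=; last by apply/forallP => i; rewrite !ffunE.
rewrite [X in _ + (_ + X)]big1 ?addr0; last first.
  move=> s /andP[_ sf1]; case: ifP => //.
  rewrite size_word big_ord1 ffunE /= add0n => /eqP s1.
  by have := f1P _ sf1; rewrite s1.
by rewrite !coef ?wE ?ffunE//= !scale1r.
Qed.

(** With single letters excluded by P, every remaining nested bracket gains an index, so coordinate
    i is determined by the coordinates before it. *)
Lemma bch_low (i : 'I_N) (P : pred nat) x x' y y' : (forall n, P n -> n != 1%N) ->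
  (forall k : 'I_N, (k < i)%N -> x ord0 k = x' ord0 k) ->
  (forall k : 'I_N, (k < i)%N -> y ord0 k = y' ord0 k) ->
  bch_sum P x y ord0 i = bch_sum P x' y' ord0 i.
Proof.
move=> P1 xx' yy'; rewrite /bch_sum !summxE; apply: eq_bigr => n _.
rewrite !summxE; apply: eq_bigr => r _; rewrite !summxE; apply: eq_bigr => s _.
case: ifP => // /P1/negbTE sz; rewrite [LHS]mxE [RHS]mxE; congr (_ * _).
apply: (@nest_br_low i) => [[] k|]; [exact: xx'|exact: yy'|].
by rewrite sz addn0.
Qed.

Lemma measurable_bch_sum d (T : measurableType d) (P : pred nat) (x y : T -> rV) :
  (forall k, measurable_fun setT (fun p => x p ord0 k)) ->
  (forall k, measurable_fun setT (fun p => y p ord0 k)) ->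
  forall k, measurable_fun setT (fun p => bch_sum P (x p) (y p) ord0 k).
Proof.
move=> mx my k; rewrite /bch_sum.
under eq_fun do rewrite summxE; apply: measurable_rsum => n.
under eq_fun do rewrite summxE; apply: measurable_rsum => r.
under eq_fun do rewrite big_mkcond summxE/=; apply: measurable_rsum => s.
case: [forall i, _]; last by under eq_fun do rewrite mxE; exact: measurable_cst.
case: (P _); last by under eq_fun do rewrite mxE; exact: measurable_cst.
under eq_fun do rewrite mxE; apply: measurable_funM; first exact: measurable_cst.
by apply: measurable_nest_br => -[].
Qed.

End bch.

(** * Integrals along measure-preserving maps, up to a null set *)

Section transfer.
Local Open Scope ereal_scope.
Context d1 d2 (T1 : measurableType d1) (T2 : measurableType d2) (R : realType).
Variables (m1 : {measure set T1 -> \bar R}) (m2 : {measure set T2 -> \bar R}).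
Variable e : T1 -> T2.
Hypothesis me : measurable_fun setT e.
Hypothesis m12 : forall A, measurable A -> m1 (e @^-1` A) = m2 A.

Lemma ge0_integral_transfer (G : T2 -> \bar R) : measurable_fun setT G ->
  (forall y, 0 <= G y) -> \int[m1]_x G (e x) = \int[m2]_y G y.
Proof.
move=> mG G0.
rewrite -[LHS](@ge0_integral_pushforward _ _ _ _ _ e me m1 setT G)//.
apply: (eq_measure_integral m2
  (m1 := measure_function_pushforward__canonical__measure_function_Measure m1 me)).
by move=> A mA _; exact: m12.
Qed.

Lemma integral_transfer (G : T2 -> \bar R) : measurable_fun setT G ->
  \int[m1]_x G (e x) = \int[m2]_y G y.
Proof.
move=> mG; rewrite [LHS]integralE [RHS]integralE.
congr (_ - _).
- rewrite -(ge0_integral_transfer (measurable_funepos mG))//.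
  by apply: eq_integral => x _; rewrite (funepos_comp G e).
- rewrite -(ge0_integral_transfer (measurable_funeneg mG))//.
  by apply: eq_integral => x _; rewrite (funeneg_comp G e).
Qed.

Lemma integrable_transfer (G : T2 -> \bar R) :
  m2.-integrable setT G -> m1.-integrable setT (fun x => G (e x)).
Proof.
move=> /integrableP[mG iG]; apply/integrableP; split.
  exact: (measurableT_comp mG).
by rewrite (@ge0_integral_transfer (fun y => `|G y|))//; exact: measurableT_comp.
Qed.

Section completion.
Variable Z : set T2.
Hypothesis mZ : measurable Z.
Hypothesis Z0 : m2 Z = 0.
Hypothesis complete_Z : forall X, X `<=` e @^-1` Z -> measurable X.
Variables (F : T1 -> \bar R) (G : T2 -> \bar R).
Hypothesis mG : measurable_fun setT G.
Hypothesis FG : forall x, ~ Z (e x) -> F x = G (e x).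

(** Off the preimage of [Z] the function is [G \o e], and inside it every set is measurable.
    Measurability of [F] is thus a conclusion, which is what the sections of the original f
    require. *)
Lemma measurable_completion : measurable_fun setT F.
Proof.
move=> _ Y mY; rewrite setTI.
rewrite (_ : F @^-1` Y = (e @^-1` (~` Z `&` G @^-1` Y)) `|`
    (F @^-1` Y `&` e @^-1` Z)); last first.
  apply/seteqP; split => [x Yx|x [[Zx /= Yx]|[]//]]; last by rewrite /= FG.
  have [Zx|Zx] := pselect (Z (e x)); first by right.
  by left; split => //; rewrite /= -FG.
apply: measurableU; last by apply: complete_Z => x [].
rewrite -[X in measurable X]setTI; apply: me => //.
apply: measurableI; first exact: measurableC.
by rewrite -[X in measurable X]setTI; exact: mG.
Qed.

Let completion_ae_eq : ae_eq m1 setT F (G \o e).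
Proof.
exists (e @^-1` Z); split.
- by rewrite -[X in measurable X]setTI; exact: me.
- by rewrite m12.
- by move=> x; apply: contra_notP => Zx _; exact: FG.
Qed.

Lemma integral_completion : \int[m1]_x F x = \int[m2]_y G y.
Proof.
rewrite -(integral_transfer mG); apply: ae_eq_integral => //.
- exact: measurable_completion.
- exact: (measurableT_comp mG).
Qed.

Lemma integrable_completion : m1.-integrable setT F <-> m2.-integrable setT G.
Proof.
have absE : \int[m1]_x `|F x| = \int[m2]_y `|G y|.
  rewrite -(@ge0_integral_transfer (fun y => `|G y|))//; last first.
    exact: measurableT_comp.
  apply: ae_eq_integral => //.
  - by apply: measurableT_comp => //; exact: measurable_completion.
  - by apply: measurableT_comp => //; exact: (measurableT_comp mG).
  - by apply: filterS completion_ae_eq => x /= h _; rewrite h.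
split=> /integrableP[_ i]; apply/integrableP; split => //.
- by rewrite -absE.
- exact: measurable_completion.
- by rewrite absE.
Qed.

End completion.
End transfer.

(** * Measures scaled by a constant *)

Section mscale.
Local Open Scope ereal_scope.
Context d (T : measurableType d) (R : realType) (m : {measure set T -> \bar R}).
Variables (k : {nonneg R}) (D : set T) (mD : measurable D).

Lemma integrable_mscale (f : T -> \bar R) :
  m.-integrable D f -> (mscale k m).-integrable D f.
Proof.
move=> /integrableP[mf intf]; apply/integrableP; split => //.
rewrite ge0_integral_mscale//; last exact: measurableT_comp.
by rewrite lte_mul_pinfty// lee_fin.
Qed.

Lemma integral_mscale (f : T -> \bar R) : m.-integrable D f ->
  \int[mscale k m]_(x in D) f x = (k%:num)%:E * \int[m]_(x in D) f x.
Proof.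
move=> intf; have mf := measurable_int _ intf.
rewrite [LHS]integralE [X in _ = _ * X]integralE muleBr//.
- by rewrite !ge0_integral_mscale//;
    [exact: measurable_funeneg|exact: measurable_funepos].
- exact: integrable_add_def.
Qed.

Lemma integrable_mscaleV (f : T -> \bar R) : (0 < k%:num)%R ->
  (mscale k m).-integrable D f -> m.-integrable D f.
Proof.
move=> k0 /integrableP[mf].
rewrite ge0_integral_mscale//; last exact: measurableT_comp.
move=> intf; apply/integrableP; split => //; rewrite ltey; apply: contraTN intf.
by move=> /eqP ->; rewrite gt0_muley ?lte_fin// ltxx.
Qed.

End mscale.

(** * Complements to Fubini's theorem *)

Section fubini_G.
Local Open Scope ereal_scope.
Context d1 d2 (T1 : measurableType d1) (T2 : measurableType d2) (R : realType).
Variable m1 : {sigma_finite_measure set T1 -> \bar R}.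
Variable m2 : {sigma_finite_measure set T2 -> \bar R}.

(** The modulus of the partial integral is at most the partial integral of the modulus, which is
    integrable by Tonelli. *)
Lemma integrable_fubini_G (f : T1 * T2 -> \bar R) :
  (m1 \x m2).-integrable setT f -> m2.-integrable setT (fubini_G m1 f).
Proof.
move=> intf; have mf := measurable_int _ intf.
have mabs : measurable_fun setT (abse \o f) by exact: measurableT_comp.
apply/integrableP; split; first exact: (measurable_fubini_G intf).
apply: le_lt_trans ((@integrable21ltyP _ _ _ _ _ m1 m2 f mf).1 intf).
apply: ge0_le_integral => //.
- by apply: measurableT_comp => //; exact: (measurable_fubini_G intf).
- by apply: (measurable_fun_fubini_tonelli_G (abse \o f)) => //=.
- by move=> y _; apply: le_abse_integral => //; exact: measurableT_comp.
Qed.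

Lemma ae_xsection_null (W : set (T1 * T2)) : measurable W ->
  (m1 \x m2) W = 0 -> {ae m1, forall x, m2 (xsection W x) = 0}.
Proof.
move=> mW W0.
have /(ae_eq_integral_abs m1 measurableT) [] := measurable_fun_xsection m2 mW.
move=> + _; rewrite (eq_integral (m2 \o xsection W)); last first.
  by move=> x _; rewrite gee0_abs// measure_ge0.
by move=> /(_ W0); apply: filterS => x /(_ I).
Qed.

Lemma ae_ysection_null (W : set (T1 * T2)) : measurable W ->
  (m1 \x m2) W = 0 -> {ae m2, forall y, m1 (ysection W y) = 0}.
Proof.
move=> mW.
(* The product measure integrates x-sections by construction; uniqueness replaces it by the one that
   integrates y-sections. *)
rewrite (@product_measure_unique _ _ _ _ _ _ _ (m1 \x^ m2))//; last first.
  by move=> A B mA mB /=; rewrite product_measure2E.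
move=> W0.
have /(ae_eq_integral_abs m2 measurableT) [] := measurable_fun_ysection m1 mW.
move=> + _; rewrite (eq_integral (m1 \o ysection W)); last first.
  by move=> x _; rewrite gee0_abs// measure_ge0.
by move=> /(_ W0); apply: filterS => x /(_ I).
Qed.

End fubini_G.

(** * Lebesgue measurable sets and functions up to Borel null sets *)

Section leb_completion.
Variables (R : realType) (N : nat) (S : pred 'I_N).
Local Notation rV := 'rV[R]_N.
Local Notation borel := (borelType R N).
Local Notation lebT := (@lebType R N S).
Local Notation leb := (@leb R N S).
Local Notation leb_borel := (@leb_borel R N S).
Local Open Scope ereal_scope.

Lemma measurable_leb_id : measurable_fun setT (id : lebT -> borel).
Proof.
apply: (@measurability _ _ lebT borel setT id (@boxes R N) erefl).
move=> _ [_ [ab ->] <-]; rewrite setTI.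
by apply: sub_sigma_algebra; left; exists ab.
Qed.

Lemma borel_leb (A : set borel) : measurable A -> measurable (A : set lebT).
Proof.
by move=> mA; rewrite -[X in measurable X]setTI; exact: (measurable_leb_id _ mA).
Qed.

Lemma leb_complete (Z : set borel) (X : set lebT) :
  leb_borel Z = 0 -> X `<=` Z -> measurable X.
Proof.
move=> Z0 XZ; apply: sub_sigma_algebra; right.
by apply/eqP; rewrite eq_le leb_outer_ge0 andbT -Z0; exact: le_leb_outer.
Qed.

(** Intersect covers of total volume at most 1/(n+1). They contain only the trace of [A] on the
    plane, so the complement of the plane, itself null, is added. *)
Lemma leb_null_hull (A : set rV) : leb_outer S A = 0 ->
  exists Z : set borel, [/\ measurable Z, leb_borel Z = 0 & A `<=` Z].
Proof.
move=> A0.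
have [F FP] : {F & forall n, box_cover S A (F n) /\
    \sum_(0 <= k <oo) (box_vol S (F n k))%:E <= (n.+1%:R^-1)%:E}.
  apply: (@choice _ _ (fun n F => box_cover S A F /\
    \sum_(0 <= k <oo) (box_vol S (F k))%:E <= (n.+1%:R^-1)%:E)) => n.
  have n0 : (0 < n.+1%:R^-1 :> R)%R by rewrite invr_gt0.
  have /(lb_ereal_inf_adherent n0)[_ [F cF <-]] : leb_outer S A \is a fin_num.
    by rewrite A0.
  by rewrite [X in _ < X + _]A0 add0e => /ltW; exists F.
pose U n : set borel := \bigcup_k box_set S (F n k).
have mb n k : measurable (box_set S (F n k) : set borel).
  by case: (F n k) => [ab|]//=; exact: borel_coord_box.
have mU n : measurable (U n) by apply: bigcupT_measurable => k; exact: mb.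
have mI : measurable (\bigcap_n U n) by apply: bigcapT_measurable => n; exact: mU.
have mP : measurable (~` coord_plane S : set borel).
  by apply: measurableC; exact: borel_coord_plane.
exists ((\bigcap_n U n) `|` ~` coord_plane S); split.
- exact: measurableU.
- rewrite measureU0//; last exact: leb_outer_setC_plane.
  apply/eqP; rewrite eq_le measure_ge0 andbT; apply/lee_addgt0Pr => e e0.
  rewrite add0e; pose n := Num.truncn e^-1.
  have ne : (n.+1%:R^-1 <= e)%R.
    by rewrite invf_ple ?posrE//; exact/ltW/truncnS_gt.
  apply: le_trans (_ : (n.+1%:R^-1)%:E <= e%:E); last by rewrite lee_fin.
  apply: le_trans (FP n).2.
  apply: (@le_trans _ _ (leb_borel (U n))).
    by apply: le_measure; rewrite ?inE// => x /(_ n I).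
  apply: le_trans (measure_sigma_subadditive leb_borel (mb n) (mU n) _) _ => //.
  apply: lee_nneseries => [k _ _|k _]; first exact: measure_ge0.
  move: ((FP n).1.1 k); case: (F n k) => [ab|] /= vab; last by rewrite measure0.
  by apply: leb_outer_box; exact: vab.
- move=> x Ax; have [Px|Px] := pselect (coord_plane S x); last by right.
  by left => n _; exact: (FP n).1.2.
Qed.

(** Sets with this property form a sigma-algebra, since countable unions of exceptional sets are
    null. Boxes need no exception, and a null set equals the empty set off its Borel hull. *)
Lemma leb_measurable_borel (A : set lebT) : measurable A ->
  exists B Z : set borel, [/\ measurable B, measurable Z, leb_borel Z = 0 &
    forall x, ~ Z x -> (A x <-> B x)].
Proof.
move: A; apply: smallest_sub; first split.
- by exists set0, set0; split => //; rewrite measure0.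
- move=> A [B [Z [mB mZ Z0 AB]]]; exists (~` B), Z; split => //.
    exact: measurableC.
  by move=> x /AB[h1 h2]; split=> [[_ nA] /h2//|nB]; split => // /h1.
- move=> F /choice[B /choice[Z BZ]].
  exists (\bigcup_n B n), (\bigcup_n Z n); split.
  + by apply: bigcupT_measurable => n; have [] := BZ n.
  + by apply: bigcupT_measurable => n; have [] := BZ n.
  + apply/eqP; rewrite eq_le measure_ge0 andbT.
    apply: le_trans (outer_measure_sigma_subadditive _ _) _.
    by rewrite eseries0// => n _ _; have [] := BZ n.
  + move=> x Zx; have nZ n : ~ Z n x by move=> Znx; apply: Zx; exists n.
    by split=> -[n _ h]; exists n => //;
      have [_ _ _ /(_ x (nZ n))[h1 h2]] := BZ n; auto.
- move=> A [[ab ->]|A0].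
    exists (coord_box predT ab), set0; split => //.
    exact: borel_coord_box.
  have [Z [mZ Z0 AZ]] := leb_null_hull A0.
  by exists set0, Z; split => // x Zx; split => // /AZ.
Qed.

Lemma leb_measurable_fun_borel (f : lebT -> R) : measurable_fun setT f ->
  exists Z : set borel, [/\ measurable Z, leb_borel Z = 0 &
    measurable_fun setT (fun x : borel => if x \in Z then 0%R else f x)].
Proof.
move=> mf.
(* An enumeration of the rationals, with 0 for integers that code none; countably many level sets
   keep the exceptional set null. *)
pose q n : R := ratr (odflt 0%R (unpickle n)).
have mE n : measurable [set x | (q n < f x)%R].
  rewrite (_ : mkset _ = setT `&` f @^-1` `]q n, +oo[%classic).
    exact: mf.
  by apply/seteqP; split => x /=; rewrite in_itv/= andbT// => -[].
have /choice[B /choice[Z BZ]] := fun n => leb_measurable_borel (mE n).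
pose W := \bigcup_n Z n.
have mW : measurable W by apply: bigcupT_measurable => n; have [] := BZ n.
have W0 : leb_borel W = 0.
  apply/eqP; rewrite eq_le measure_ge0 andbT.
  apply: le_trans (outer_measure_sigma_subadditive _ _) _.
  by rewrite eseries0// => n _ _; have [] := BZ n.
exists W; split => //; apply: measurable_fun_rays => a.
(* Off [W] a rational lies between a and the value of f. On [W] the new function is 0, so [W]
   belongs to the level set exactly when a < 0. *)
rewrite (_ : mkset _ =
    (\bigcup_n (if (a <= q n)%R then B n `\` W else set0)) `|`
    (if (a < 0)%R then W else set0)).
  apply: measurableU; last by case: ifP.
  apply: bigcupT_measurable => n; case: ifP => // _.
  by apply: measurableD => //; have [] := BZ n.
apply/seteqP; split => x /=.
  case: ifPn => [|/negP xW].
    by rewrite inE => Wx a0; right; rewrite a0.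
  move=> /rat_in_itvoo[r]; rewrite in_itv/= => /andP[ar rf]; left.
  exists (pickle r) => //; have qr : q (pickle r) = ratr r by rewrite /q pickleK.
  have nW : ~ W x by move=> Wx; apply: xW; rewrite inE.
  rewrite qr (ltW ar); split => //.
  have [_ _ _ /(_ x)[]] := BZ (pickle r).
    by move=> Zx; apply: nW; exists (pickle r).
  by rewrite /= qr => + _; exact.
move=> [[n _]|]; last by case: ifP => // a0 Wx; rewrite mem_set.
case: ifP => // aq [Bx nW]; rewrite memNset//.
have [_ _ _ /(_ x)[]] := BZ n; first by move=> Zx; apply: nW; exists n.
by move=> _ /(_ Bx); exact: le_lt_trans.
Qed.

End leb_completion.

Section completed_lebesgue.
Variable R : realType.
Local Notation cR := (caratheodory_type (R := R) (wlength idfun)^*%mu).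

Lemma measurable_completed_id : measurable_fun setT
  (id : cR -> measurableTypeR R).
Proof. by move=> _ Y mY; rewrite setTI; exact: sub_caratheodory. Qed.

Lemma completed_complete (Z : set (measurableTypeR R)) (X : set cR) :
  measurable Z -> lebesgue_measure Z = 0%E -> X `<=` Z -> measurable X.
Proof.
move=> mZ Z0 XZ; apply: completed_lebesgue_measure_is_complete.
by exists Z; split => //; exact: sub_caratheodory.
Qed.

End completed_lebesgue.

(** * The map (p, t) to p exp(t X_j) preserves measure *)

Section flow.
Variables (R : realType) (N : nat).
Local Notation rV := 'rV[R]_N.
Local Notation borel := (borelType R N).
Variables (c : 'I_N -> 'I_N -> 'I_N -> R) (sigma : 'I_N -> nat) (j : 'I_N).
Hypothesis carnot : carnot_algebra c sigma.
Local Notation S := [pred i : 'I_N | i != j].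

(** The nonlinear BCH part of p exp(t X_j) as a function of x = p + t e_j: clearing x_j recovers p,
    and t is x_j. *)
Let Q i (x : borel) : R :=
  bch_sum c (predC1 1%N) (set_coord j x 0) (expX j ((x : rV) ord0 j)) ord0 i.

(** The j-th coordinate of the first component is discarded, so this is the product with exp(t X_j)
    only for points of Pi_j, which carry the measure. *)
Definition flow (z : borel * measurableTypeR R) : borel :=
  let x : rV := insert_coord j z in
  cmul c (set_coord j x 0) (expX j (x ord0 j)).

Lemma flow_Pi (p : rV) t : Pi j p -> flow (p, t) = cmul c p (expX j t).
Proof.
move=> pj; rewrite /flow /insert_coord /= set_coordE eqxx; congr cmul.
by apply/rowP => k; rewrite !set_coordE; case: eqVneq => // ->; rewrite pj.
Qed.

Let flowE z : flow z =
  \row_i ((insert_coord j z : rV) ord0 i + Q i (insert_coord j z)).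
Proof.
rewrite /flow /cmul; move: (insert_coord j z : rV) => x /=.
have N0 : (0 < N)%N by exact: leq_ltn_trans (ltn_ord j).
apply/rowP => i; rewrite bch_split bch_sum1// [LHS]mxE [RHS]mxE; congr (_ + _).
by rewrite !mxE; case: eqVneq => [->|_]; rewrite ?add0r ?mulr1 ?mulr0 ?addr0.
Qed.

Let measurable_expX k : measurable_fun setT
  (fun x : borel => expX j ((x : rV) ord0 j) ord0 k).
Proof.
under eq_fun do rewrite !mxE; apply: measurable_funM; last exact: measurable_cst.
exact: measurable_fun_coord.
Qed.

Let measurable_Q i : measurable_fun setT (Q i).
Proof.
apply: measurable_bch_sum => k; last exact: measurable_expX.
under eq_fun do rewrite set_coordE.
by case: (k == j); [exact: measurable_cst|exact: measurable_fun_coord].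
Qed.

Let row_map (x : borel) : borel := \row_i ((x : rV) ord0 i + Q i x).

Let measurable_row_map : measurable_fun setT row_map.
Proof.
apply: measurable_fun_rV => k; under eq_fun do rewrite mxE.
by apply: measurable_funD; [exact: measurable_fun_coord|exact: measurable_Q].
Qed.

Lemma measurable_flow : measurable_fun setT flow.
Proof.
rewrite (_ : flow = row_map \o insert_coord j); last first.
  by apply/funext => z; exact: flowE.
exact: measurableT_comp measurable_row_map (@measurable_insert_coord R N j).
Qed.

Lemma leb_borel_flow (A : set borel) : measurable A ->
  (@leb_borel R N S \x @lebesgue_measure R)%E (flow @^-1` A) =
  @leb_borel R N predT A.
Proof.
move=> mA; rewrite -(@leb_borel_triangular R N Q A)//; last first.
  move=> i x y xy; apply: (bch_low carnot) => [n|k ki|k ki]; first by [].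
    by rewrite !set_coordE; case: eqP => // _; exact: xy.
  (* The second BCH argument has its only possibly nonzero entry, x_j, at index j; it is compared
     only when j < i, where x and y agree. *)
  rewrite !mxE; case: eqVneq => [kj|_]; last by rewrite !mulr0.
  by rewrite -kj xy.
rewrite (@leb_borel_slice R N predT j)//; last first.
  by rewrite -[X in measurable X]setTI; exact: measurable_row_map.
congr (_ _); apply/seteqP; split => z /=; rewrite flowE//.
Qed.

End flow.

Lemma Pi_coord_plane (R : realType) (N : nat) (j : 'I_N) :
  Pi j = coord_plane [pred i | i != j] :> set 'rV[R]_N.
Proof.
apply/seteqP; split => x; last by apply; rewrite /= eqxx.
by move=> xj i /=; rewrite negbK => /eqP ->.
Qed.

(** The identity from the completed space to the Borel one preserves measure, and all subsets of the
    null set [Z] are measurable in the completion. *)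
Lemma leb_completion (R : realType) (N : nat) (S : pred 'I_N)
    (Z : set (borelType R N)) (F : @lebType R N S -> \bar R)
    (G : borelType R N -> \bar R) :
  measurable Z -> @leb_borel R N S Z = 0%E -> measurable_fun setT G ->
  (forall x, ~ Z x -> F x = G x) ->
  ((@leb R N S).-integrable setT F <-> (@leb_borel R N S).-integrable setT G) /\
  (\int[@leb R N S]_x F x = \int[@leb_borel R N S]_x G x)%E.
Proof.
move=> mZ Z0 mG FG; have mid := @measurable_leb_id R N S.
by split; [apply: (integrable_completion mid _ mZ Z0)|
  apply: (integral_completion mid _ mZ Z0)] => // X; exact: leb_complete.
Qed.

Lemma lebesgue_completion (R : realType) (Z : set R) (F G : R -> \bar R) :
  measurable Z -> lebesgue_measure Z = 0%E -> measurable_fun setT G ->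
  (forall t, ~ Z t -> F t = G t) ->
  ((@completed_lebesgue_measure R).-integrable setT F <->
    (@lebesgue_measure R).-integrable setT G) /\
  (\int[@completed_lebesgue_measure R]_t F t =
    \int[@lebesgue_measure R]_t G t)%E.
Proof.
move=> mZ Z0 mG FG; have mid := @measurable_completed_id R.
by split; [apply: (integrable_completion mid _ mZ Z0)|
  apply: (integral_completion mid _ mZ Z0)] => // X; exact: completed_complete.
Qed.

(** * Fubini's theorem along the integral curves of X_j *)

Theorem mainTheorem2 (R : realType) (N : nat)
    (c : 'I_N -> 'I_N -> 'I_N -> R) (sigma : 'I_N -> nat)
    (ThetaG ThetaPi : R) (j : 'I_N) (f : 'rV[R]_N -> R) :
  carnot_algebra c sigma ->
  sigma j = 1%N ->
  0 < ThetaG -> 0 < ThetaPi ->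
  let HG : set (@lebType R N predT) -> \bar R :=
    fun A => (ThetaG%:E * leb_outer predT A)%E in
  let HPi : set (@lebType R N [pred i | i != j]) -> \bar R :=
    fun A => (ThetaPi%:E * leb_outer [pred i | i != j] A)%E in
  let g (p : 'rV[R]_N) (t : R) : R := f (cmul c p (expX j t)) in
  HG.-integrable setT (fun x : @lebType R N predT => (f x)%:E) ->
  [/\ {ae HPi, forall p : @lebType R N [pred i | i != j], Pi j p ->
          (@completed_lebesgue_measure R).-integrable setT
            (fun t => (g p t)%:E)},
      {ae (@completed_lebesgue_measure R), forall t,
          HPi.-integrable (Pi j) (fun p => (g p t)%:E)},
      (\int[HPi]_(p in Pi j) \int[@completed_lebesgue_measure R]_t (g p t)%:E
         = \int[@completed_lebesgue_measure R]_t \int[HPi]_(p in Pi j) (g p t)%:E)%E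
    & (\int[@completed_lebesgue_measure R]_t \int[HPi]_(p in Pi j) (g p t)%:E
         = (ThetaPi / ThetaG)%:E * \int[HG]_(x in setT) (f x)%:E)%E].
Proof.
move=> carnot _ G0 P0 HG HPi g intf.
pose kG : {nonneg R} := NngNum (ltW G0); pose kP : {nonneg R} := NngNum (ltW P0).
pose S : pred 'I_N := [pred i | i != j].
pose nu := @leb_borel R N S; pose lam := @lebesgue_measure R.
pose clam := @completed_lebesgue_measure R.
(* [HG] and [HPi] are bare set functions; being convertible with scaled measures gives them the
   theory of measures. *)
have HGE : HG = mscale kG (@leb R N predT) by [].
have HPiE : HPi = mscale kP (@leb R N S) by [].
have {}intf : (@leb R N predT).-integrable setT (fun x => (f x)%:E).
  by apply: (@integrable_mscaleV _ _ _ _ kG) => //; rewrite -HGE.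
have mf : measurable_fun setT (f : @lebType R N predT -> R).
  by apply/measurable_EFinP; exact: measurable_int intf.
have [Z [mZ Z0]] := leb_measurable_fun_borel mf.
set f' := (fun x : borelType R N => _) => mf'.
have f'E x : ~ Z x -> f' x = f x by move=> Zx; rewrite /f' memNset.
have mf'E : measurable_fun setT (fun x => (f' x)%:E) by exact/measurable_EFinP.
have [[/(_ intf) intf' _] intfE] := leb_completion (F := fun x => (f x)%:E)
  mZ Z0 mf'E (fun x Zx => esym (congr1 EFin (f'E x Zx))).
pose h z := (f' (flow c j z))%:E.
have mflow := measurable_flow c j.
have pflow := leb_borel_flow j carnot.
have inth : (nu \x lam)%E.-integrable setT h by exact: integrable_transfer intf'.
have hE : (\int[nu \x lam]_z h z = \int[@leb_borel R N predT]_x (f' x)%:E)%E.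
  exact: (integral_transfer mflow pflow).
have mh : measurable_fun setT h by exact: measurable_int inth.
(* The pairs (p, t) where f and its Borel representative may differ at the image point. *)
pose W := flow c j @^-1` Z.
have mW : measurable W by rewrite -[W]setTI; exact: mflow.
have W0 : (nu \x lam)%E W = 0%E by rewrite pflow.
have gE p t : Pi j p -> ~ W (p, t) -> (g p t)%:E = h (p, t).
  by move=> pj Wpt; rewrite /h f'E// flow_Pi.
have mPi : measurable (Pi j : set (borelType R N)).
  by rewrite Pi_coord_plane; exact: borel_coord_plane.
have mPiL : measurable (Pi j : set (@lebType R N S)) by exact: borel_leb.
have PiC0 : nu (~` Pi j) = 0%E.
  by rewrite Pi_coord_plane; exact: leb_outer_setC_plane.
have null_PiC Y : measurable Y -> nu Y = 0%E -> nu (Y `|` ~` Pi j) = 0%E.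
  by move=> mY Y0; rewrite [LHS]measureU0//; exact: measurableC.
have sec1 p : lam (xsection W p) = 0%E ->
    lam.-integrable setT (fun t => h (p, t)) ->
    Pi j p -> clam.-integrable setT (fun t => (g p t)%:E) /\
    (\int[clam]_t (g p t)%:E = fubini_F lam h p)%E.
  move=> W0p ih pj; have mWp := measurable_xsection p mW.
  have [] := lebesgue_completion (F := fun t => (g p t)%:E) mWp W0p
    (measurable_int _ ih).
    by move=> t Wt; apply: gE => // Wpt; apply: Wt; rewrite /xsection /= inE.
  by move=> [_ /(_ ih)].
have sec2 t : nu (ysection W t) = 0%E ->
    nu.-integrable setT (fun p => h (p, t)) ->
    (@leb R N S).-integrable (Pi j) (fun p => (g p t)%:E) /\
    (\int[@leb R N S]_(p in Pi j) (g p t)%:E = fubini_G nu h t)%E.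
  move=> W0t ih; have mWt := measurable_ysection t mW.
  (* The integrand over Pi_j is extended by zero but h is not, so the null complement of Pi_j joins
     the exceptional set. *)
  have mWt' := measurableU _ _ mWt (measurableC mPi).
  have [] := leb_completion (F := (fun p => (g p t)%:E) \_ (Pi j)) mWt'
    (null_PiC _ mWt W0t) (measurable_int _ ih).
    move=> p /not_orP[Wp /contrapT pj]; rewrite patchE mem_set//.
    by apply: gE => // Wpt; apply: Wp; rewrite /ysection /= inE.
  move=> [_ /(_ ih) ig] igE; split; first exact/integrable_mkcond.
  by rewrite integral_mkcond.
(* Outside [Y1] the section of [W] is null and that of h integrable, so the completed integral of g
   along the curve exists and equals that of h. *)
have [Y1 [mY1 Y10 Y1P]] : {ae nu, forall p, lam (xsection W p) = 0%E /\
    lam.-integrable setT (fun t => h (p, t))}.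
  by apply: filterS2 (ae_xsection_null mW W0) (ae_integrable1 inth).
have [Y2 [mY2 Y20 Y2P]] : {ae lam, forall t, nu (ysection W t) = 0%E /\
    nu.-integrable setT (fun p => h (p, t))}.
  by apply: filterS2 (ae_ysection_null mW W0) (ae_integrable2 inth).
have good1 p : ~ Y1 p -> Pi j p ->
    clam.-integrable setT (fun t => (g p t)%:E) /\
    (\int[clam]_t (g p t)%:E = fubini_F lam h p)%E.
  move=> Yp pj; have [] : _ /\ _ := contrapT (fun np => Yp (Y1P p np)).
  by move=> Wp ihp; exact: sec1.
have good2 t : ~ Y2 t ->
    (@leb R N S).-integrable (Pi j) (fun p => (g p t)%:E) /\
    (\int[@leb R N S]_(p in Pi j) (g p t)%:E = fubini_G nu h t)%E.
  move=> Yt; have [] : _ /\ _ := contrapT (fun nt => Yt (Y2P t nt)).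
  exact: sec2.
have fub1 : (\int[HPi]_(p in Pi j) \int[clam]_t (g p t)%:E =
    ThetaPi%:E * \int[nu \x lam]_z h z)%E.
  have mY1' := measurableU _ _ mY1 (measurableC mPi).
  have [] := leb_completion
    (F := (fun p => (\int[clam]_t (g p t)%:E)%E) \_ (Pi j)) mY1'
    (null_PiC _ mY1 Y10) (measurable_int _ (integrable_fubini_F inth)).
    move=> p /not_orP[Yp /contrapT pj]; rewrite patchE mem_set//.
    by have [] := good1 _ Yp pj.
  move=> [_ /(_ (integrable_fubini_F inth)) iF] FE.
  rewrite HPiE integral_mscale//; last exact/integrable_mkcond.
  by rewrite integral_mkcond FE integral12_prod_meas1.
have fub2 : (\int[clam]_t \int[HPi]_(p in Pi j) (g p t)%:E =
    ThetaPi%:E * \int[nu \x lam]_z h z)%E.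
  have iG := integrable_fubini_G inth.
  have [] := lebesgue_completion
    (F := fun t => (\int[HPi]_(p in Pi j) (g p t)%:E)%E) mY2 Y20
    (measurable_int _ (integrableZl measurableT ThetaPi iG)).
    move=> t Yt; rewrite HPiE integral_mscale//; last by have [] := good2 _ Yt.
    by have [_ ->] := good2 _ Yt.
  by move=> _ ->; rewrite integralZl// integral21_prod_meas1.
split.
- exists Y1; split; first exact: borel_leb.
    by rewrite /HPi [X in (_ * X)%E](Y10 : leb_outer _ _ = _) mule0.
  by move=> p; apply: contra_notP => Yp pj; have [] := good1 _ Yp pj.
- exists Y2; split; [exact: sub_caratheodory|exact: Y20|].
  move=> t; apply: contra_notP => Yt; rewrite HPiE; apply: integrable_mscale => //.
  by have [] := good2 _ Yt.
- by rewrite fub1 fub2.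
(* The integral against [HG] carries a factor [ThetaG], cancelled by the denominator; [ThetaPi]
   comes from [HPi]. *)
- rewrite fub2 hE -intfE HGE integral_mscale// muleA -EFinM.
  by rewrite divfK// gt_eqF.
Qed.
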